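(* Let $I\subset\mathbb{R}$ be an interval with infinite length, and let $u:I\to\mathbb{R}$ be an absolutely continuous function such that $V(u')<\infty$. Then $$\|u'\|_\infty^2\le 48\,\|u\|_\infty\left(\|DM(u'^+)\|_\infty+\|DM(u'^-)\|_\infty\right).$$ If $I=\mathbb{R}$, then $$\|u'\|_\infty^2\le 24\,\|u\|_\infty\left(\|DM(u'^+)\|_\infty+\|DM(u'^-)\|_\infty\right).$$
   Context: An interval means a nondegenerate interval of $\mathbb{R}$. $\lambda$ is Lebesgue measure. $u'$ is the pointwise derivative of $u$, which exists almost everywhere; $V(g)=\sup\sum_{j=2}^L|g(x_j)-g(x_{j-1})|$, the supremum over all finite sets $x_1<\dots<x_L$ in the domain of $g$ (so $V(u')<\infty$ means that $u'$, on the set where it exists, has bounded variation; equivalently $u'$ agrees a.e. with a function of bounded variation on $I$). $g^+=\max\{g,0\}$ and $g^-=\max\{-g,0\}$. For locally integrable $g$ on $I$, $Mg(x)=\sup_{x\in J\subset I}\frac{1}{\lambda(J)}\int_J|g(y)|\,dy$, the supremum being over intervals $J\subset I$ of finite length containing $x$ (noncentered Hardy-Littlewood maximal function). $DMg$ is the distributional derivative of $Mg$; when $Mg$ is absolutely continuous (as is the case here for $g=u'^{\pm}$) it coincides with the a.e. pointwise derivative. $\|\cdot\|_\infty$ is the essential supremum norm on $I$, possibly $+\infty$, and the convention $\infty\cdot 0=\infty$ is used. *)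

(* Defs.v *)
From mathcomp Require Import all_boot all_order all_algebra.
From mathcomp Require Import all_classical all_reals all_analysis.

Set Implicit Arguments.
Unset Strict Implicit.
Unset Printing Implicit Defensive.

Import Order.TTheory GRing.Theory Num.Theory.
Import numFieldNormedType.Exports.

Local Open Scope classical_set_scope.
Local Open Scope ring_scope.

(* A function on an interval I is represented by a total function R -> R of
   which only the values on I are used. *)

Definition absolutely_continuous_on (R : realType) (I : set R) (u : R -> R) :=
  forall e : R, 0 < e -> exists2 d : R, 0 < d &
    forall (n : nat) (a b : 'I_n -> R),
      (forall i, [/\ I (a i), I (b i) & a i <= b i]) ->
      trivIset [set: 'I_n] (fun i => `]a i, b i[%classic) ->
      \sum_(i < n) (b i - a i) < d ->
      \sum_(i < n) `|u (b i) - u (a i)| < e.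

(* The domain of u'; the value of u' there is derive1 u x. An endpoint of I is
   left out: outside I, u is arbitrary. *)
Definition derive1_dom (R : realType) (I : set R) (u : R -> R) : set R :=
  [set x | I° x /\ derivable u x 1].

Definition variation_on (R : realType) (D : set R) (g : R -> R) : \bar R :=
  ereal_sup [set (\sum_(0 <= j < (size s).-1) `|g s`_j.+1 - g s`_j|)%:E
            | s in [set s : seq R | sorted <%R s /\ forall x, x \in s -> D x]].

Definition Linfty_norm (R : realType) (I : set R) (f : R -> R) : \bar R :=
  'N[@lebesgue_measure R]_+oo%E[(EFin \o f) \_ I]%E.

(* [iavg g J] is the average of |g| over J. *)
Definition maximal_on (R : realType) (I : set R) (g : R -> R) (x : R) : \bar R :=
  ereal_sup [set iavg g J
            | J in [set J : set R | [/\ is_interval J, J `<=` I, J x &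
                (0 < lebesgue_measure J < +oo)%E]]].

(* C_c^oo(U) *)
Definition test_function (R : realType) (U : set R) (phi : R -> R) :=
  (forall (n : nat) (x : R), derivable (derive1n n phi) x 1) /\
  exists K : set R, [/\ compact K, K `<=` U & forall x, ~ K x -> phi x = 0].

Definition is_distributional_derivative (R : realType) (U : set R)
    (f : R -> \bar R) (h : R -> R) :=
  [/\ forall K, compact K -> K `<=` U -> (@lebesgue_measure R).-integrable K f,
      locally_integrable U h &
      forall phi : R -> R, test_function U phi ->
        (\int[lebesgue_measure]_(x in U) (f x * (derive1 phi x)%:E) =
         - \int[lebesgue_measure]_(x in U) (h x * phi x)%:E)%E].

(* The L^oo norm of the distributional derivative of f. That derivative is
   unique up to a null set, so the infimum is over at most one value; it is +oo
   when the derivative is not a locally integrable function. *)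
Definition Linfty_norm_distr_deriv (R : realType) (I : set R)
    (f : R -> \bar R) : \bar R :=
  ereal_inf [set Linfty_norm I h
            | h in [set h | is_distributional_derivative I° f h]].

(* The product on [0, +oo] with the convention oo * 0 = oo, whereas the
   library has +oo * 0 = 0. *)
Definition mule_oo (R : realType) (x y : \bar R) : \bar R :=
  if (x == +oo%E) || (y == +oo%E) then +oo%E else (x * y)%E.

(* Main.v *)
(** Let [f = u'], [N] its essential sup norm, and suppose that [f^+] comes within
    [N / 64] of [N] on a set of positive measure (otherwise replace [u] by [-u]).
    Since the distributional derivative of the maximal function [P = M (f^+)] is
    bounded by [K], [P] is a.e. equal to a [K]-Lipschitz function, so [P > c N]
    a.e. on a window of length proportional to [N / K], where [c = 27 / 32].
    Hence almost every point of the window lies in an interval [J] on which [f^+]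
    has average above [c N], and then the increase of [u] over [J] is at least
    [(2 c - 1) N |J|], because [f = 2 f^+ - |f|]. Covering the window by such
    intervals with no point covered three times, the increase of [u] over
    their union is at least [(4 c - 3) N] times its length: overlaps are the
    worst case, and there the slope [2 c - 1] is counted twice while [u] grows at
    most at the rate [N]. As [u] oscillates by at most [2 U], where [U] is its sup
    norm, this bounds [N^2] by a multiple of [U K], with a window twice as long if
    it can be centred, as on the whole line. Bounded variation of [u'] makes [N]
    finite. *)
Require Import Defs.
From HB Require Import structures.
From mathcomp Require Import all_boot all_order all_algebra.
From mathcomp Require Import all_classical all_reals all_analysis.
From mathcomp Require Import measurable_realfun ess_sup_inf ring lra.

Set Implicit Arguments.
Unset Strict Implicit.
Unset Printing Implicit Defensive.

Import Order.TTheory GRing.Theory Num.Theory.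
Import numFieldNormedType.Exports.

Local Open Scope classical_set_scope.
Local Open Scope ring_scope.

Section almost_everywhere.
Context {R : realType}.
Notation mu := (@lebesgue_measure R).

(** The bound on [DM] constrains the maximal function only as a distribution: its values can be
    compared only at Lebesgue points, so the lower bound on the window holds off a null set. Points
    of that null set need not lie in any steep interval; they are put in an open set of measure
    below an arbitrary [e], on which [u] may fall at rate N, at a total cost of at most 2 N e. A
    steep interval cannot be trimmed, since a part of it need not be steep. Overlaps are therefore
    unavoidable, and they lower the rate from 2 c - 1 to 4 c - 3. Constants: the maximal function
    exceeds N - N / 64 at the starting point and loses at most N / 8 within distance s = N / (8 K)
    of it, and 1 - 1/64 - 1/8 = 55/64 exceeds c = 54/64. As 4 c - 3 = 3/8, a window of length s
    gives N^2 <= (128/3) U K and one of length 2 s gives N^2 <= (64/3) U K, within 48 and 24.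
    Whichever sign of [f] comes close to N, its norm is at most the sum of the two. *)

Lemma ae_mono (P Q : R -> Prop) : {ae mu, forall x, P x} ->
  (forall x, P x -> Q x) -> {ae mu, forall x, Q x}.
Proof.
by move=> + PQ; apply: filterS; [exact: (ae_filter_ringOfSetsType mu)|exact: PQ].
Qed.

Lemma ae_and (P Q : R -> Prop) : {ae mu, forall x, P x} -> {ae mu, forall x, Q x} ->
  {ae mu, forall x, P x /\ Q x}.
Proof.
by move=> aP aQ; apply: filterI => //; exact: (ae_filter_ringOfSetsType mu).
Qed.

End almost_everywhere.

(** * Absolutely continuous functions *)

Section ac.
Context {R : realType}.
Implicit Types (I : set R) (u F : R -> R) (a b x y : R) (s : seq R).

(** An arbitrary finite index type allows families indexed by pairs: an interval and a cell of its
    partition. *)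
Lemma absolutely_continuous_on_fin I u : absolutely_continuous_on I u ->
  forall e : R, 0 < e -> exists2 d : R, 0 < d &
    forall (T : finType) (a b : T -> R),
      (forall i, [/\ I (a i), I (b i) & a i <= b i]) ->
      trivIset [set: T] (fun i => `]a i, b i[%classic) ->
      \sum_i (b i - a i) < d -> \sum_i `|u (b i) - u (a i)| < e.
Proof.
move=> acu e e0; have [d d0 H] := acu e e0; exists d => // T a b ab tab sab.
have bij : {on [pred _ | true], bijective (@enum_val T T)}.
  exact: onW_bij (enum_val_bij T).
rewrite (reindex _ bij)/=; apply: (H _ (a \o enum_val) (b \o enum_val)) => //.
- by move=> i; exact: ab.
- move=> i j _ _ ij; apply: enum_val_inj; exact: tab.
- by move: sab; rewrite (reindex _ bij).
Qed.

Lemma absolutely_continuous_on_continuous F :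
  absolutely_continuous_on setT F -> continuous F.
Proof.
move=> acF x; apply/cvgrPdist_lt => e e0.
have [d d0 H] := acF e e0.
have H1 a b : a <= b -> b - a < d -> `|F b - F a| < e.
  move=> ab bad; have := H 1%N (fun=> a) (fun=> b); rewrite !big_ord1.
  by apply => // i j _ _ _; rewrite !ord1.
near=> y.
have xyd : `|x - y| < d by near: y; apply: cvgr_dist_lt.
have [xy|yx] := leP x y.
  by rewrite distrC; apply: H1 => //; rewrite -(ger0_norm (_ : 0 <= y - x)) ?subr_ge0// distrC.
by apply: H1; [exact: ltW|rewrite -(gtr0_norm (_ : 0 < x - y)) ?subr_gt0].
Unshelve. all: by end_near. Qed.

Lemma itv_partition_trivIset a b s : itv_partition a b s ->
  trivIset [set: 'I_(size s)]
    (fun j => `]nth b (a :: s) j, nth b (a :: s) j.+1[%classic).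
Proof.
move=> [ps ls].
have le_nth i j : (i <= j)%N -> (j <= size s)%N -> nth b (a :: s) i <= nth b (a :: s) j.
  move=> ij js. 
  have : sorted <=%R (a :: s) by apply: sub_path ps => x y /ltW.
  move=> /(sorted_leq_nth le_trans lexx b); apply => //.
    by rewrite inE/= ltnS (leq_trans ij).
have main (i j : 'I_(size s)) x : nth b (a :: s) i < x < nth b (a :: s) i.+1 ->
   nth b (a :: s) j < x < nth b (a :: s) j.+1 -> ~~ (i < j)%N.
  move=> /andP[_ xi] /andP[jx _]; apply/negP => ij.
  have := le_nth i.+1 j ij (ltnW (ltn_ord j)).
  by rewrite leNgt (lt_trans jx xi).
move=> i j _ _ [x [/= xi xj]]; apply/val_inj => /=; apply/eqP.
rewrite !in_itv/= in xi xj.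
by rewrite eqn_leq leqNgt (main _ _ _ xj xi) leqNgt (main _ _ _ xi xj).
Qed.

Lemma itv_partition_bounds a b s (j : nat) : itv_partition a b s ->
  (j <= size s)%N -> a <= nth b (a :: s) j <= b.
Proof.
move=> [ps /eqP ls] js.
have ss : sorted <=%R (a :: s) by apply: sub_path ps => x y /ltW.
have := sorted_leq_nth le_trans lexx b ss.
move=> mono; apply/andP; split.
  by apply: (mono 0%N j) => //; rewrite inE/= ltnS.
have e : nth b (a :: s) (size s) = b by rewrite -[RHS]ls (last_nth b).
by rewrite -[leRHS]e; apply: (mono j (size s)) => //; rewrite inE/= ltnS.
Qed.

(** The cells of all the partitions form one disjoint family with the same total length, to which
    absolute continuity applies at once. *)
Lemma variation_sum_lt I u : is_interval I -> absolutely_continuous_on I u ->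
  forall e : R, 0 < e -> exists2 d : R, 0 < d &
    forall n (a b : 'I_n -> R) (s : 'I_n -> seq R),
      (forall i, [/\ I (a i), I (b i) & itv_partition (a i) (b i) (s i)]) ->
      trivIset [set: 'I_n] (fun i => `]a i, b i[%classic) ->
      \sum_(i < n) (b i - a i) < d ->
      \sum_(i < n) variation (a i) (b i) u (s i) < e.
Proof.
move=> itvI acu e e0; have [d d0 H] := absolutely_continuous_on_fin acu e0.
exists d => // n a b s abs tab sab.
pose x i j := nth (b i) (a i :: s i) j.
have x_bnd i j : (j <= size (s i))%N -> a i <= x i j <= b i.
  by have [_ _ h] := abs i; exact: itv_partition_bounds.
have Ix i j : (j <= size (s i))%N -> I (x i j).
  by move=> /x_bnd xij; have [Ia Ib _] := abs i; exact: itvI xij.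
have x_mono i (j : 'I_(size (s i))) : x i j <= x i j.+1.
  have [_ _ [ps _]] := abs i.
  by have := ltW ((pathP (b i) ps) j (ltn_ord j)).
pose T := {i : 'I_n & 'I_(size (s i))}.
have := H T (fun p => x (tag p) (tagged p)) (fun p => x (tag p) (tagged p).+1).
have sumT (f : forall i : 'I_n, nat -> R) :
    \sum_(p : T) f (tag p) (tagged p) =
    \sum_(i < n) \sum_(0 <= j < size (s i)) f i j.
  transitivity (\sum_(i < n) \sum_(j < size (s i)) f i j).
    by rewrite sig_big_dep.
  by apply: eq_bigr => i _; rewrite big_mkord.
rewrite (sumT (fun i j => x i j.+1 - x i j)).
rewrite (sumT (fun i j => `|u (x i j.+1) - u (x i j)|)).
apply => //.
- move=> [i j]; split => /=; [exact/Ix/ltnW|exact/Ix|exact: x_mono].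
- move=> [i j] [i' j'] _ _ /= [y [/= yi yi']].
  have ii' : i = i'.
    apply: tab => //; exists y; rewrite /= in_itv/= in yi yi' *.
    have /andP[a1 b1] := x_bnd i j (ltnW (ltn_ord j)).
    have /andP[a2 b2] := x_bnd i j.+1 (ltn_ord j).
    have /andP[a3 b3] := x_bnd i' j' (ltnW (ltn_ord j')).
    have /andP[a4 b4] := x_bnd i' j'.+1 (ltn_ord j').
    move: yi yi' => /andP[y1 y2] /andP[y3 y4]; split; rewrite in_itv/=.
      by rewrite (le_lt_trans a1)// (lt_le_trans y2).
    by rewrite (le_lt_trans a3)// (lt_le_trans y4).
  subst i'; congr existT.
  have [_ _ h] := abs i.
  by apply: (itv_partition_trivIset h) => //; exists y.
- rewrite (eq_bigr (fun i => b i - a i))// => i _.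
  rewrite telescope_sumr//; have [_ _ h] := abs i.
  by rewrite /x (itv_partition_nth_size _ h).
Qed.
End ac.

(** * Total variation and the Jordan decomposition *)

Section tv.
Context {R : realType}.
Implicit Types (I : set R) (u F : R -> R) (a b x y : R) (s : seq R).

Lemma absolutely_continuous_on_total_variation I u : is_interval I ->
  absolutely_continuous_on I u ->
  forall e : R, 0 < e -> exists2 d : R, 0 < d &
    forall n (a b : 'I_n -> R),
      (forall i, [/\ I (a i), I (b i) & a i <= b i]) ->
      trivIset [set: 'I_n] (fun i => `]a i, b i[%classic) ->
      \sum_(i < n) (b i - a i) < d ->
      (forall i, bounded_variation (a i) (b i) u) /\
      \sum_(i < n) fine (total_variation (a i) (b i) u) <= e.
Proof.
move=> itvI acu e e0; have [d d0 H] := variation_sum_lt itvI acu e0.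
exists d => // n a b Iab tab sab.
have bv i : bounded_variation (a i) (b i) u.
  exists e => _ [s ps <-]; apply: ltW.
  have := H 1%N (fun=> a i) (fun=> b i) (fun=> s); rewrite !big_ord1; apply.
  - by move=> _; have [] := Iab i.
  - by move=> j k _ _ _; rewrite !ord1.
  - apply: le_lt_trans sab; rewrite (bigD1 i)//= lerDl sumr_ge0// => j _.
    by rewrite subr_ge0; have [] := Iab j.
split => //; rewrite leNgt; apply/negP => lte.
(* If the sum exceeded [e], giving up one share [eta] of the excess on each of the [n] intervals
   would still leave at least [e]; dividing by [n.+1] covers [n = 0]. *)
pose eta := (\sum_(i < n) fine (total_variation (a i) (b i) u) - e) / n.+1%:R.
have eta0 : 0 < eta by rewrite divr_gt0// subr_gt0.
have /choice[s ps] i : exists s, itv_partition (a i) (b i) s /\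
    fine (total_variation (a i) (b i) u) - eta < variation (a i) (b i) u s.
  have [_ _ ab] := Iab i.
  have ftv : total_variation (a i) (b i) u \is a fin_num by apply/bounded_variationP.
  have /ereal_sup_gt[_ [_ [s ps <-] <-]] :
      ((fine (total_variation (a i) (b i) u) - eta)%:E
        < total_variation (a i) (b i) u)%E.
    by rewrite -[ltRHS]fineK// lte_fin ltrBlDr ltrDl.
  by rewrite lte_fin => h; exists s.
have : \sum_(i < n) variation (a i) (b i) u (s i) < e.
  by apply: H => // i; have [? ? _] := Iab i; have [] := ps i.
apply/negP; rewrite -leNgt.
apply: (@le_trans _ _ (\sum_(i < n) (fine (total_variation (a i) (b i) u) - eta))).
  rewrite sumrB sumr_const card_ord -mulr_natr lerBrDl -lerBrDr.
  rewrite -[leRHS](@divfK _ n.+1%:R)// -/eta ler_pM2l//.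
  by rewrite ler_nat.
by apply: ler_sum => i _; have [_ /ltW] := ps i.
Qed.

Lemma absolutely_continuous_on_bounded_variation I u a b : is_interval I ->
  absolutely_continuous_on I u -> I a -> I b -> a <= b ->
  bounded_variation a b u.
Proof.
move=> itvI acu Ia Ib ab.
have [d d0 H] := absolutely_continuous_on_total_variation itvI acu ltr01.
have small x y : a <= x -> x <= y -> y <= b -> y - x < d -> bounded_variation x y u.
  move=> ax xy yb xyd.
  have Ix : I x by apply: (itvI a b) => //; rewrite ax (le_trans xy).
  have Iy : I y by apply: (itvI a b) => //; rewrite yb (le_trans ax).
  have := H 1%N (fun=> x) (fun=> y); rewrite !big_ord1.
  by case => // [i j _ _ _|/(_ ord0)]; rewrite ?ord1// !ord1.
(* Induction on the number of steps of length [d / 2] from [a]: the variation over each step is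
   finite, and variations add up. *)
suff main k x : a <= x -> x <= b -> x <= a + k%:R * (d / 2) -> bounded_variation a x u.
  apply: (main (Num.bound ((b - a) / (d / 2)))) => //.
  rewrite -lerBlDl -ler_pdivrMr ?divr_gt0//; apply: ltW.
  by apply: archi_boundP; rewrite divr_ge0 ?subr_ge0// divr_ge0// ltW.
elim: k x => [x ax xb|k ih x ax xb].
  rewrite mul0r addr0 => xa; have -> : x = a by apply/eqP; rewrite eq_le xa.
  exact: bounded_variationxx.
rewrite -natr1 mulrDl mul1r addrA => xk.
pose c := Num.max a (x - d / 2).
have ac : a <= c by rewrite le_max lexx.
have cx : c <= x by rewrite ge_max ax gerBl divr_ge0// ltW.
apply/bounded_variationP => //; rewrite (total_variationD _ ac cx) fin_numD.
apply/andP; split; apply/bounded_variationP => //.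
  apply: ih => //; first exact: le_trans xb.
  by rewrite ge_max lerDl mulr_ge0 ?divr_ge0 ?(ltW d0)//= lerBlDr.
apply: small => //; rewrite ltrBlDr -ltrBlDl lt_max; apply/orP; right.
by rewrite ltrD2l ltrN2 ltr_pdivrMr// mulr2n mulrDr mulr1 ltrDl.
Qed.

(** [F] is the variation of [u] from [A], and [G] is [F - u]. Clamping the argument to [[A, B]]
    extends both to the whole line, where Stieltjes measures are defined. *)
Lemma absolutely_continuous_on_decomposition I u A B : is_interval I ->
  absolutely_continuous_on I u -> I A -> I B -> A <= B ->
  exists F G : R -> R, [/\ {homo F : x y / x <= y}, {homo G : x y / x <= y},
    absolutely_continuous_on setT F, absolutely_continuous_on setT G &
    forall x, A <= x <= B -> u x = F x - G x].
Proof.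
move=> itvI acu IA IB AB.
pose c x := Num.max A (Num.min B x).
have Ac x : A <= c x by rewrite le_max lexx.
have cB x : c x <= B by rewrite ge_max AB ge_min lexx.
have cE x : A <= x <= B -> c x = x.
  by move=> /andP[Ax xB]; rewrite /c min_r// max_r.
have c_nd : {homo c : x y / x <= y}.
  by move=> x y xy; rewrite /c !maxEle !minEle; do !case: ifP; lra.
have c_lip x y : x <= y -> c y - c x <= y - x.
  by move=> xy; rewrite /c !maxEle !minEle; do !case: ifP; lra.
have Ic x : I (c x) by apply: (itvI A B) => //; rewrite Ac cB.
have bvc x : bounded_variation A (c x) u.
  exact: (absolutely_continuous_on_bounded_variation itvI acu).
have tvfin x y : x <= y -> total_variation (c x) (c y) u \is a fin_num.
  move=> xy; apply/bounded_variationP; first exact: c_nd.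
  by apply: (absolutely_continuous_on_bounded_variation itvI acu) => //; exact: c_nd.
pose F x := fine (total_variation A (c x) u).
have FB x y : x <= y -> F y - F x = fine (total_variation (c x) (c y) u).
  move=> xy; rewrite /F (total_variationD _ (Ac x) (c_nd _ _ xy)) fineD ?tvfin//.
    by rewrite addrC addKr.
  exact/bounded_variationP.
have uF x y : x <= y -> `|u (c y) - u (c x)| <= F y - F x.
  move=> xy; rewrite FB// -lee_fin fineK ?tvfin//.
  by apply: total_variation_ge; exact: c_nd.
have acF : absolutely_continuous_on setT F.
  move=> e e0; have e20 : 0 < e / 2 by rewrite divr_gt0.
  have [d d0 H] := absolutely_continuous_on_total_variation itvI acu e20.
  exists d => // n a b ab tab sab.
  have cab i : c (a i) <= c (b i) by apply: c_nd; have [] := ab i.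
  have [|||_ h] := H n (c \o a) (c \o b).
  - by move=> i; split => //=.
  - move=> i j _ _ [t [/=]]; rewrite !in_itv/= => ti tj.
    have ct k : c (a k) < t < c (b k) -> a k < t < b k.
      by rewrite /c !gt_max !lt_max !gt_min !lt_min; lra.
    by apply: tab => //; exists t; split; rewrite /= in_itv/=; exact: ct.
  - apply: le_lt_trans sab; apply: ler_sum => i _ /=.
    by apply: c_lip; have [] := ab i.
  - rewrite (eq_bigr (fun i => fine (total_variation (c (a i)) (c (b i)) u))).
      by apply: le_lt_trans h _; rewrite ltr_pdivrMr// mulr2n mulrDr mulr1 ltrDl.
    move=> i _; have [_ _ abi] := ab i; rewrite -FB// ger0_norm//.
    by rewrite (le_trans _ (uF _ _ abi)).
have ndF : {homo F : x y / x <= y}.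
  by move=> x y xy; rewrite -subr_ge0 (le_trans _ (uF _ _ xy)).
exists F, (fun x => F x - u (c x)); split => //.
- move=> x y xy; have := uF _ _ xy; rewrite ler_norml; lra.
- move=> e e0; have e20 : 0 < e / 2 by rewrite divr_gt0.
  have [d d0 H] := acF _ e20; exists d => // n a b ab tab sab.
  have := H n a b ab tab sab; rewrite ltr_pdivlMr// mulrC mulr_natl mulr2n.
  rewrite -big_split/=; apply: le_lt_trans; apply: ler_sum => i _.
  have [_ _ abi] := ab i; have := uF _ _ abi.
  have FF : `|F (b i) - F (a i)| = F (b i) - F (a i).
    by rewrite ger0_norm// subr_ge0 ndF.
  by rewrite !FF !ler_norml; lra.
- by move=> x /cE xE; rewrite xE; ring.
Qed.

End tv.

(** * Densities of monotone absolutely continuous functions *)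

Section rn.
Context {R : realType}.
Implicit Types (I : set R) (u F : R -> R) (a b x y : R) (s : seq R).
Notation mu := (@lebesgue_measure R).

Lemma open_interval_itvoo (J : set R) a b : open J -> is_interval J ->
  J `<=` `]a, b[%classic -> exists x y, x <= y /\ J = `]x, y[%classic.
Proof.
move=> oJ iJ Jab; have [->|/set0P J0] := eqVneq J set0.
  by exists a, a; rewrite lexx set_itvoo0.
have lJ : has_lbound J by exists a => t /Jab; rewrite /= in_itv/= => /andP[/ltW].
have uJ : has_ubound J by exists b => t /Jab; rewrite /= in_itv/= => /andP[_ /ltW].
exists (inf J), (sup J); split.
  by case: J0 => t Jt; rewrite (le_trans (ge_inf lJ Jt))// ub_le_sup.
by rewrite -interval_bounded_interior//; apply/esym/interior_id.
Qed.

(** Radon-Nikodym for the Stieltjes measure of [F] cut down to []A, B]], where it is finite;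
    absolute continuity of [F] is what makes it dominated by Lebesgue measure. *)
Lemma nondecreasing_absolutely_continuous_density F A B : A <= B ->
  {homo F : x y / x <= y} -> absolutely_continuous_on setT F ->
  exists2 h : R -> R, mu.-integrable setT (EFin \o h) &
    forall x y, A <= x -> x <= y -> y <= B ->
      F y - F x = (\int[mu]_(t in `]x, y]) h t)%R.
Proof.
move=> AB ndF acF.
have rcF : forall x, F z @[z --> x^'+] --> F x.
  by apply: right_continuousW; exact: absolutely_continuous_on_continuous.
pose mF := isCumulative.Build R _ R F ndF rcF.
pose Fc : cumulative R R := HB.pack F mF.
pose nu : {measure set (measurableTypeR R) -> \bar R} := lebesgue_stieltjes_measure Fc.
have nuE x y : x <= y -> nu `]x, y]%classic = (F y - F x)%:E.
  move=> xy; rewrite /nu /= /lebesgue_stieltjes_measure /measure_extension.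
  rewrite measurable_mu_extE/=; last exact: is_ocitv.
  by rewrite wlength_itv_bnd.
have mitv x y : measurable (`]x, y]%classic : set (measurableTypeR R)).
  by apply: sub_sigma_algebra; exact: is_ocitv.
have nuoo : (nu `]A, B]%classic < +oo)%E by rewrite nuE// ltry.
pose nuf := mfrestr (mitv A B) nuoo.
have dom : nuf `<< mu.
  apply/null_content_dominatesP => Z mZ Z0.
  apply/eqP; rewrite eq_le measure_ge0 andbT.
  apply/lee_addgt0Pr => e e0; rewrite add0e.
  have [d d0 H] := acF e e0.
  have Zoo : (mu Z < +oo)%E by rewrite Z0.
  have [U [oU ZU Ud]] := lebesgue_regularity_outer mZ Zoo d0.
  pose V := U `&` `]A - 1, B + 1[%classic.
  have oV : open V by apply: openI => //; exact: interval_open.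
  have mU : measurable (U : set (measurableTypeR R)) by exact: open_measurable.
  have Vd : (mu V < d%:E)%E.
    have VZ : V `<=` Z `|` (U `\` Z).
      by move=> t [Ut _]; have [Zt|nZt] := pselect (Z t); [left|right].
    apply: le_lt_trans Ud; rewrite -[leRHS]add0e -Z0.
    have mUZ := measurableD mU mZ.
    apply: le_trans (measureU2 mu mZ mUZ); apply: le_measure => //.
      by rewrite inE; exact: open_measurable.
    by rewrite inE; exact: measurableU.
  have [J [oiJ tJ VJ]] := OpenSetDisjointItvs.open_disjoint_itv oV.
  have /choice[ab abJ] k : exists p : R * R, p.1 <= p.2 /\ J k = `]p.1, p.2[%classic.
    have [oJk iJk] := oiJ k.
    have [|x [y [xy Jxy]]] := @open_interval_itvoo (J k) (A - 1) (B + 1) oJk iJk.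
      apply: subset_trans (@subIsetr _ U _); rewrite -/V VJ.
      exact: bigcup_sup.
    by exists (x, y).
  have mJ k : measurable (J k : set (measurableTypeR R)).
    by rewrite (abJ k).2; exact: measurable_itv.
  apply: (@le_trans _ _ (nu V)).
    rewrite /nuf /mfrestr /mrestr; apply: le_measure; rewrite ?inE//.
    - exact: measurableI.
    - exact: open_measurable oV.
    - move=> t [/ZU Ut]; rewrite /= in_itv/= => /andP[At tB]; split => //.
      by rewrite /= in_itv/=; lra.
  rewrite VJ measure_bigcup//=.
  have -> : (\sum_(i <oo | i \in setT) nu (J i) = \sum_(i <oo) nu (J i))%E.
    by apply: eq_eseriesl => i; rewrite in_setT.
  (* Absolute continuity speaks of finite families, so the series is bounded through its partial
     sums. *)
  apply: lime_le; first exact: is_cvg_nneseries.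
  apply: nearW => n.
  have sJ : (\sum_(i < n) ((ab i).2 - (ab i).1) < d)%R.
    rewrite -lte_fin; apply: le_lt_trans Vd; rewrite VJ measure_bigcup//.
    have -> : (\sum_(i <oo | i \in setT) mu (J i) = \sum_(i <oo) mu (J i))%E.
      by apply: eq_eseriesl => i; rewrite in_setT.
    apply: le_trans (nneseries_lim_ge n _) => //.
    rewrite big_mkord -sumEFin; apply: lee_sum => i _.
    have [abi ->] := abJ i; rewrite lebesgue_measure_itv/= lte_fin.
    by case: ltP => //= ba; rewrite lee_fin subr_le0.
  have := H n (fun i => (ab i).1) (fun i => (ab i).2).
  move=> /(_ _ _ sJ) H1.
  rewrite big_mkord; apply: (@le_trans _ _ (\sum_(i < n) (F (ab i).2 - F (ab i).1)%:E)%E).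
    apply: lee_sum => i _; have [abi ->] := abJ i; rewrite -nuE//.
    apply: le_measure; rewrite ?inE//.
    by move=> t; rewrite /= !in_itv/= => /andP[-> /ltW].
  rewrite sumEFin lee_fin; apply: ltW.
  apply: le_lt_trans (H1 _ _).
  - by apply: ler_sum => i _; exact: ler_norm.
  - by move=> i; split => //; have [] := abJ i.
  - move=> i j _ _ [t [ti tj]]; apply/val_inj/tJ => //; exists t.
    by rewrite !(abJ _).2.
have [h [h0 hfin ih hE]] := radon_nikodym_sigma_finite dom.
have hE' : EFin \o (fine \o h) = h by apply/funext => x /=; rewrite fineK.
exists (fine \o h); first by rewrite hE'.
move=> x y Ax xy yB; rewrite /Rintegral [X in integral _ _ X]hE' -hE//.
transitivity (fine (nu (`]x, y] `&` `]A, B])%classic)) => //.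
rewrite setIidl ?nuE// => t.
by rewrite /= !in_itv/= => /andP[xt ty]; rewrite (le_lt_trans Ax)// (le_trans ty).
Qed.

End rn.

(** * Measurability of the derivative *)

Section derive1_measurable.
Context {R : realType}.

Let q (w : R -> R) (h x : R) : R := h^-1 * (w (h + x) - w x).

(* Off the set where [w] is derivable, [derive1 w] is constant: the default value
   of [lim]. *)
Lemma measurable_derive1 (w : R -> R) : continuous w ->
  measurable_fun setT (derive1 w).
Proof.
move=> cw.
have cq h : continuous (q w h).
  move=> x; apply: cvgM; first exact: cvg_cst.
  apply: cvgB; last exact: cw.
  apply: (@continuous_comp _ _ _ (fun y => h + y) w); last exact: cw.
  by apply: cvgD; [exact: cvg_cst|exact: cvg_id].
(* Cauchy criterion: [w] is derivable at [x] when for every [k] some [C k m] contains [x]. Each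
   [C k m] is an intersection of closed conditions, since the difference quotients are continuous in
   [x]. *)
pose C k m := [set x | forall h h', 0 < `|h| < m.+1%:R^-1 -> 0 < `|h'| < m.+1%:R^-1 ->
  `|q w h x - q w h' x| <= k.+1%:R^-1].
have closedC k m : closed (C k m).
  have -> : C k m = \bigcap_(p in [set p : R * R | 0 < `|p.1| < m.+1%:R^-1 /\
      0 < `|p.2| < m.+1%:R^-1])
      ((fun x => `|q w p.1 x - q w p.2 x|) @^-1` [set y | y <= k.+1%:R^-1]).
    apply/seteqP; split => x /= H; first by move=> [h h'] /= [h1 h2]; exact: H.
    by move=> h h' h1 h2; apply: (H (h, h')).
  apply: closed_bigI => p _; apply: closed_comp; last exact: closed_le.
  move=> x _; apply: cvg_norm; apply: cvgB; exact: cq.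
pose D := \bigcap_k \bigcup_m C k m.
have mD : measurable D.
  apply: bigcapT_measurable => k; apply: bigcup_measurable => m _.
  exact: closed_measurable.
have derE x : D x <-> cvg (q w h x @[h --> 0^']).
  split=> [Dx|].
    apply/cauchy_cvgP; apply: cauchy_exP => e e0.
    have [k ke] : exists k : nat, k.+1%:R^-1 < e.
      by have [k _ /(_ k (leqnn k))] := near_infty_natSinv_lt (PosNum e0); exists k.
    have [m _ Cx] := Dx k I.
    exists (q w (m.+2%:R^-1) x); exists (m.+1%:R^-1) => /=; first by rewrite invr_gt0.
    move=> h /=; rewrite sub0r normrN => hm h0; rewrite /ball/=.
    apply: le_lt_trans ke; apply: Cx; last by rewrite normr_gt0 h0 hm.
    by rewrite gtr0_norm ?invr_gt0//= ltf_pV2 ?posrE// ?ltr_nat ?ltnSn ?ltr0n.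
  move=> /cvg_ex[/= l /cvgrPdist_le ql] k _.
  have e0 : (0 : R) < k.+1%:R^-1 / 2 by rewrite divr_gt0.
  have [d /= d0 H] := ql _ e0.
  have [m md] : exists m : nat, m.+1%:R^-1 < d.
    by have [m _ /(_ m (leqnn m))] := near_infty_natSinv_lt (PosNum d0); exists m.
  exists m => // h h' /andP[h0 hm] /andP[h'0 h'm].
  have Hh t : 0 < `|t| -> `|t| < m.+1%:R^-1 -> `|l - q w t x| <= k.+1%:R^-1 / 2.
    move=> t0 tm; apply: H; first by rewrite /= sub0r normrN (lt_trans tm).
    by rewrite -normr_gt0.
  have := Hh _ h0 hm; have := Hh _ h'0 h'm; set e := k.+1%:R^-1; rewrite !ler_norml; lra.
rewrite -(setvU D); apply/(measurable_funU _ (measurableC mD) mD); split.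
  apply: (@eq_measurable_fun _ _ _ _ _ (cst (point : R))) => //.
  move=> x /set_mem/= nDx; rewrite /derive1.
  by rewrite dvgP//; move=> /derE.
apply: (@measurable_fun_cvg _ _ _ _ (fun n => q w (n.+1%:R^-1))).
  by move=> m; apply: measurable_funTS; exact: continuous_measurable_fun.
move=> x /derE /cvg_ex[l ql].
have -> : derive1 w x = l by apply/cvg_lim; [exact: Rhausdorff|exact: ql].
apply: (@cvg_comp _ _ _ (fun n : nat => (n.+1%:R^-1 : R)) (fun h => q w h x) _
  (0^')); last exact: ql.
move=> P [d /= d0 dP].
have [m _ H] := near_infty_natSinv_lt (PosNum d0).
exists m => // n /= mn; apply: dP => /=; last by rewrite gt_eqF ?invr_gt0.
by rewrite sub0r normrN gtr0_norm ?invr_gt0//; exact: H.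
Qed.

End derive1_measurable.

(** * The fundamental theorem of calculus for absolutely continuous functions *)

Section ftc.
Context {R : realType}.
Implicit Types (I : set R) (u F : R -> R).
Notation mu := (@lebesgue_measure R).

(** The densities of the two monotone parts make [u] the integral of some [h]; Lebesgue
    differentiation identifies [h] with the derivative of [u] almost everywhere. *)
Lemma absolutely_continuous_on_FTC I u A B : is_interval I ->
  absolutely_continuous_on I u -> I A -> I B -> A < B ->
  [/\ {ae mu, forall x, A < x < B -> derivable u x 1},
    measurable_fun `]A, B[ (derive1 u),
    mu.-integrable `]A, B[ (EFin \o derive1 u) &
    forall x y, A <= x -> x <= y -> y <= B ->
      u y - u x = (\int[mu]_(t in `]x, y[) derive1 u t)%R].
Proof.
move=> itvI acu IA IB AB.
have [F [G [ndF ndG acF acG uFG]]] :=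
  absolutely_continuous_on_decomposition itvI acu IA IB (ltW AB).
have [f intf Ff] := nondecreasing_absolutely_continuous_density (ltW AB) ndF acF.
have [g intg Gg] := nondecreasing_absolutely_continuous_density (ltW AB) ndG acG.
pose h x := f x - g x.
have inth : mu.-integrable setT (EFin \o h).
  exact: (integrableB measurableT intf intg).
have inthS E : measurable E -> mu.-integrable E (EFin \o h).
  by move=> mE; exact: integrableS inth.
have uh x y : A <= x -> x <= y -> y <= B -> u y - u x = (\int[mu]_(t in `]x, y]) h t)%R.
  move=> Ax xy yB; rewrite RintegralB//.
  - by rewrite -Ff// -Gg// !uFG ?Ax ?yB ?(le_trans Ax) ?(le_trans xy)//; ring.
  - exact: integrableS intf.
  - exact: integrableS intg.
have loch : locally_integrable setT h by exact: open_integrable_locally openT inth.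
have near_u x : A < x < B ->
    \forall t \near x, (\int[mu]_(z in `]A, t]) h z)%R = u t - u A.
  move=> /andP[Ax xB]; near=> t; rewrite uh//.
    by apply: ltW; near: t; exact: lt_nbhsr.
  by apply: ltW; near: t; exact: lt_nbhsl.
have der_u : {ae mu, forall x, A < x < B -> derivable u x 1 /\ derive1 u x = h x}.
  have := @FTC1 _ h (BRight A) (fun y => inthS _ (measurable_itv _)) loch.
  move=> /ae_mono; apply => x /= H AxB.
  have [|derH Hh] := H; first by case/andP: AxB.
  have Hx : is_derive x (1 : R) (fun t => \int[mu]_(z in `]A, t]) h z)%R (h x).
    by apply: (DeriveDef derH); rewrite -derive1E; exact: Hh.
  have : is_derive x (1 : R) u (h x + 0).
    apply: near_eq_is_derive (is_deriveD Hx (is_derive_cst (u A) x (1 : R))).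
    near=> t; rewrite /= fctE (_ : (\int[mu]_(z in `]A, t]) h z)%R = u t - u A) ?subrK//.
    by near: t; exact: near_u.
  by rewrite addr0 => -[? <-]; rewrite derive1E.
have md : measurable_fun `]A, B[ (derive1 u).
  (* [u] is arbitrary outside [I]; near each point of []A, B[] it coincides with [F \- G], which is
     continuous on the whole line. *)
  have cFG : continuous (F \- G).
    by move=> x; apply: cvgB; exact: absolutely_continuous_on_continuous.
  apply: (@eq_measurable_fun _ _ _ _ _ (derive1 (F \- G))).
    move=> x /set_mem/=; rewrite in_itv/= => /andP[Ax xB].
    rewrite !derive1E; apply: near_eq_derive; near=> t.
    rewrite uFG//; apply/andP; split; apply: ltW; near: t.
      exact: lt_nbhsr.
    exact: lt_nbhsl.
  by apply: measurable_funTS; exact: measurable_derive1.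
have aeq : ae_eq mu `]A, B[%classic (EFin \o h) (EFin \o derive1 u).
  apply: ae_mono der_u _ => x H; rewrite /= in_itv/= => /H[_ ->] //.
have mh : measurable_fun setT h by case: loch.
have mhS E : measurable E -> measurable_fun E (EFin \o h).
  by move=> mE; apply/measurable_EFinP; exact: measurable_funS mh.
have intd : mu.-integrable `]A, B[ (EFin \o derive1 u).
  apply/integrableP; split; first exact/measurable_EFinP.
  have /integrableP[_] := inthS _ (measurable_itv `]A, B[).
  suff -> : (\int[mu]_(t in `]A, B[) `|(EFin \o h) t| =
      \int[mu]_(t in `]A, B[) `|(EFin \o derive1 u) t|)%E by [].
  apply: ge0_ae_eq_integral => //.
  - by apply: measurableT_comp => //; exact: mhS.
  - by apply: measurableT_comp => //; exact/measurable_EFinP.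
  - by apply: filterS aeq => t H /H /= [->].
split => //.
  by apply: ae_mono der_u _ => x H /H[].
move=> x y Ax xy yB; rewrite uh// -Rintegral_itv_bndo_bndc; last exact: inthS.
rewrite /Rintegral; congr fine.
have sub : `]x, y[%classic `<=` `]A, B[%classic.
  move=> t; rewrite /= !in_itv/= => /andP[xt ty].
  by rewrite (le_lt_trans Ax)// (lt_le_trans ty).
apply: ae_eq_integral => //.
- exact: mhS.
- by apply/measurable_EFinP; apply: measurable_funS md.
- exact: ae_eq_subset aeq.
Unshelve. all: by end_near. Qed.

End ftc.

(** * Smooth test functions *)

Section smooth.
Context {R : realType}.
Implicit Types (f g : R -> R) (p : {poly R}).

(** All derivatives of order at most [n] are derivable. Recursion on the derivative turns closure
    under sums, products and inverses into an induction on [n]. *)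
Fixpoint Cn (n : nat) f : Prop := (forall x, derivable f x 1) /\
  if n is m.+1 then Cn m (derive1 f) else True.

Lemma Cn_derivable n f x : Cn n f -> derivable f x 1.
Proof. by case: n => [|n] []. Qed.

Lemma Cn_derivable1n n f x : Cn n f -> derivable (derive1n n f) x 1.
Proof.
elim: n f => [|n ih] f /=; first by case.
by move=> [_ /ih]; rewrite -iterS iterSr.
Qed.

Lemma CnS n f : Cn n.+1 f -> Cn n f.
Proof. by elim: n f => [|n ih] f [df cf]; split => //; exact: ih. Qed.

Lemma is_derive_derive1 f x : derivable f x 1 -> is_derive x 1 f (derive1 f x).
Proof. by move=> df; apply: (DeriveDef df); rewrite derive1E. Qed.

Lemma is_derive_derive1E f g : (forall x, is_derive x (1 : R) f (g x)) ->
  derive1 f = g.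
Proof. by move=> fg; apply/funext => x; rewrite derive1E; apply: derive_val. Qed.

Lemma CnSI n f g : (forall x, is_derive x (1 : R) f (g x)) -> Cn n g -> Cn n.+1 f.
Proof.
by move=> fg cg; split; [move=> x; have [] := fg x|rewrite (is_derive_derive1E fg)].
Qed.

Lemma Cn0I f g : (forall x, is_derive x (1 : R) f (g x)) -> Cn 0 f.
Proof. by move=> fg; split => // x; have [] := fg x. Qed.

Lemma Cn_cst n c : Cn n (fun=> c).
Proof.
elim: n c => [|n ih] c.
  by apply: (@Cn0I _ (fun=> 0)) => x; exact: is_derive_cst.
by apply: (@CnSI _ _ (fun=> 0)) => // x; exact: is_derive_cst.
Qed.

Lemma CnD n f g : Cn n f -> Cn n g -> Cn n (fun x => f x + g x).
Proof.
have dfg f' g' : (forall x, derivable f' x 1) -> (forall x, derivable g' x 1) ->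
    forall x, is_derive x (1 : R) (fun x => f' x + g' x) (derive1 f' x + derive1 g' x).
  by move=> df dg x; apply: is_deriveD; exact: is_derive_derive1.
elim: n f g => [|n ih] f g [df cf] [dg cg]; first exact: Cn0I (dfg _ _ df dg).
by apply: CnSI (dfg _ _ df dg) _; exact: ih.
Qed.

Lemma CnM n f g : Cn n f -> Cn n g -> Cn n (fun x => f x * g x).
Proof.
have dfg f' g' : (forall x, derivable f' x 1) -> (forall x, derivable g' x 1) ->
    forall x, is_derive x (1 : R) (fun x => f' x * g' x)
      (f' x * derive1 g' x + derive1 f' x * g' x).
  move=> df dg x; have := is_deriveM (is_derive_derive1 (df x)) (is_derive_derive1 (dg x)).
  by rewrite /GRing.scale/= [g' x * _]mulrC.
elim: n f g => [|n ih] f g cf cg.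
  by case: cf cg => [df _] [dg _]; exact: Cn0I (dfg _ _ df dg).
have [[df cf'] [dg cg']] := (cf, cg).
by apply: CnSI (dfg _ _ df dg) _; apply: CnD; apply: ih => //; exact: CnS.
Qed.

Lemma CnV n g : (forall x, g x != 0) -> Cn n g -> Cn n (fun x => (g x)^-1).
Proof.
move=> g0.
have dg' : (forall x, derivable g x 1) -> forall x, is_derive x (1 : R) (fun x => (g x)^-1)
      (-1 * derive1 g x * ((g x)^-1 * (g x)^-1)).
  move=> dg x; have := is_deriveV (g0 x) (is_derive_derive1 (dg x)).
  suff -> : -1 * derive1 g x * ((g x)^-1 * (g x)^-1) =
      - (g x) ^- 2 *: derive1 g x by [].
  by rewrite -exprVn /GRing.scale/=; ring.
elim: n => [|n ih] cg; first by case: cg => dg _; exact: Cn0I (dg' dg).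
have [dg cg'] := cg.
apply: CnSI (dg' dg) _; have {}ih := ih (CnS cg).
by apply: CnM; [apply: CnM => //; exact: Cn_cst|exact: CnM].
Qed.

Lemma is_derive_comp_affine f a b x : derivable f (a * x + b) 1 ->
  is_derive x (1 : R) (fun x => f (a * x + b)) (a * derive1 f (a * x + b)).
Proof.
move=> df.
have h : is_derive x (1 : R) (fun x => a * x + b) a.
  have := is_deriveD (is_deriveM (is_derive_cst a x (1 : R)) (is_derive_id x (1 : R)))
    (is_derive_cst b x (1 : R)).
  by rewrite /GRing.scale/= mulr0 addr0 mulr1 addr0.
have := @is_derive1_comp _ f (fun x => a * x + b) x _ _ (is_derive_derive1 df) h.
by rewrite mulrC.
Qed.

Lemma Cn_comp_affine n f a b : Cn n f -> Cn n (fun x => f (a * x + b)).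
Proof.
elim: n f => [|n ih] f [df cf].
  by apply: Cn0I => x; exact: is_derive_comp_affine.
apply: CnSI => [x|]; first exact: is_derive_comp_affine.
by apply: CnM; [exact: Cn_cst|exact: ih].
Qed.

End smooth.

(** * A smooth transition from 0 to 1 *)

Section smooth_step.
Context {R : realType}.
Implicit Types (p : {poly R}).

(** Horner induction: half of the exponent serves the quotient by ['X], and the other half absorbs
    the factor [s], as [e / 2 * s <= expR (e / 2 * s)]. *)
Lemma poly_le_expR p (e : R) : 0 < e ->
  exists2 C, 0 <= C & forall s, 0 <= s -> `|p.[s]| <= C * expR (e * s).
Proof.
elim/poly_ind: p e => [|p c ih] e e0.
  by exists 0 => // s _; rewrite horner0 normr0 mul0r.
have e20 : 0 < e / 2 by rewrite divr_gt0.
have [C C0 H] := ih _ e20.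
exists (C * (e / 2)^-1 + `|c|) => [|s s0].
  by rewrite addr_ge0// mulr_ge0// invr_ge0 ltW.
rewrite hornerD hornerM hornerX hornerC (le_trans (ler_normD _ _))// mulrDl lerD//; last first.
  by rewrite ler_peMr// -[leLHS](@expR0 R) ler_expR mulr_ge0// ltW.
rewrite normrM (ger0_norm s0).
apply: (@le_trans _ _ (C * expR (e / 2 * s) * ((e / 2)^-1 * expR (e / 2 * s)))).
  apply: ler_pM => //; first exact: H.
  rewrite ler_pdivlMl//; apply: le_trans (expR_ge1Dx _); lra.
have -> : expR (e * s) = expR (e / 2 * s) * expR (e / 2 * s).
  by rewrite -expRD; congr expR; lra.
by rewrite le_eqVlt; apply/orP; left; apply/eqP; ring.
Qed.

(* [p(1/t) exp(-1/t)]: this class of functions is closed under differentiation. *)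
Definition flat p (t : R) := if 0 < t then p.[t^-1] * expR (- t^-1) else 0.

(** The polynomial of the derivative of [flat p]: the variable s = 1/t has derivative -s^2. *)
Definition flat' p : {poly R} := 'X^2 * (p - p^`()).

(** A quadratic bound forces the derivative at 0 to vanish, whatever [p]. Half of the exponential
    pays for ['X * p], which yields one factor [t]; the other half, exp(-1/(2t)), is at most 2t. *)
Lemma flat_bound p : exists2 C, 0 <= C & forall t : R, `|flat p t| <= C * t ^+ 2.
Proof.
have e0 : (0 : R) < 1 / 2 by rewrite divr_gt0.
have [C C0 H] := poly_le_expR ('X * p) e0.
exists (C * 2) => [|t]; first by rewrite mulr_ge0.
rewrite /flat; case: ifPn => [t0|_]; last first.
  by rewrite normr0 mulr_ge0 ?sqr_ge0// mulr_ge0.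
have tV0 : 0 <= t^-1 by rewrite invr_ge0 ltW.
have := H _ tV0; rewrite hornerM hornerX normrM (ger0_norm tV0).
rewrite ler_pdivrMl// => H1.
rewrite normrM [X in _ * X]ger0_norm ?expR_ge0//.
apply: (@le_trans _ _ (t * (C * expR (1 / 2 / t)) * expR (- t^-1))).
  by rewrite ler_wpM2r ?expR_ge0.
have -> : t * (C * expR (1 / 2 / t)) * expR (- t^-1) = t * (C * expR (- (1 / 2 / t))).
  by rewrite -!mulrA; congr (_ * (_ * _)); rewrite -expRD; congr expR; field; rewrite gt_eqF.
have -> : C * 2 * t ^+ 2 = t * (C * (2 * t)) by ring.
rewrite ler_pM2l// ler_wpM2l//.
rewrite expRN -[leRHS]invrK lef_pV2 ?posrE ?expR_gt0 ?invr_gt0 ?mulr_gt0//.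
by apply: le_trans (expR_ge1Dx _); rewrite invfM div1r lerDr.
Qed.

Lemma is_derive_flat p (t : R) : is_derive t (1 : R) (flat p) (flat (flat' p) t).
Proof.
have [t0|t0|->] := ltgtP t 0.
- apply: (@near_eq_is_derive _ _ _ (fun=> 0)); last first.
    by rewrite /flat ltNge (ltW t0)/=; exact: is_derive_cst.
  near=> s; rewrite /flat ltNge.
  suff -> : s <= 0 by [].
  by apply: ltW; near: s; exact: lt_nbhsl.
- apply: (@near_eq_is_derive _ _ _ (fun s : R => p.[s^-1] * expR (- s^-1))).
    near=> s; rewrite /flat.
    suff -> : 0 < s by [].
    by near: s; exact: lt_nbhsr.
  have tn0 : t != 0 by rewrite gt_eqF.
  have dV : is_derive t (1 : R) (fun s => s^-1) (- t ^- 2).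
    have := is_deriveV tn0 (is_derive_id t (1 : R)).
    by rewrite /GRing.scale/= mulr1.
  have dp : is_derive t (1 : R) (fun s => p.[s^-1]) (p^`().[t^-1] * - t ^- 2).
    exact: (@is_derive1_comp _ (horner p) (fun s => s^-1)).
  have dN : is_derive t (1 : R) (fun s => - s^-1) (t ^- 2).
    by have := is_deriveN dV; rewrite opprK.
  have de : is_derive t (1 : R) (fun s => expR (- s^-1)) (expR (- t^-1) * t ^- 2).
    exact: (@is_derive1_comp _ expR (fun s => - s^-1)).
  have := is_deriveM dp de; rewrite /flat t0 /GRing.scale/=.
  suff -> : (flat' p).[t^-1] * expR (- t^-1) =
     p.[t^-1] * (expR (- t^-1) * t ^- 2) + expR (- t^-1) * (p^`().[t^-1] * - t ^- 2) by [].
  by rewrite /flat' hornerM hornerXn hornerD hornerN exprVn; ring.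
- have [C C0 H] := flat_bound p.
  have f0 q : flat q 0 = 0 by rewrite /flat ltxx.
  have lim0 : h^-1 *: (flat p (h *: 1 + 0) - flat p 0) @[h --> 0^'] --> (0 : R).
    apply/cvgrPdist_le => e e0.
    have d0 : 0 < e / (C + 1) by rewrite divr_gt0// ltr_wpDl.
    exists (e / (C + 1)) => //= h; rewrite /ball_/= sub0r normrN => he h0.
    rewrite sub0r normrN f0 subr0 /GRing.scale/= mulr1 addr0 normrM normfV.
    rewrite ler_pdivrMl ?normr_gt0//; apply: le_trans (H h) _.
    have -> : h ^+ 2 = `|h| * `|h| by rewrite -normrM -expr2 ger0_norm ?sqr_ge0.
    rewrite mulrCA ler_pM2l ?normr_gt0//.
    move: he; rewrite ltr_pdivlMr ?ltr_wpDl// => /ltW; apply: le_trans.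
    by rewrite mulrC ler_wpM2l// lerDl.
  rewrite f0; apply: DeriveDef; first by apply/cvg_ex; exists 0; exact: lim0.
  by apply/cvg_lim; [exact: Rhausdorff|exact: lim0].
Unshelve. all: by end_near. Qed.

Lemma Cn_flat n p : Cn n (flat p).
Proof.
elim: n p => [|n ih] p; first exact: Cn0I (is_derive_flat p).
by apply: CnSI (is_derive_flat p) _; exact: ih.
Qed.

Lemma flat1_ge0 (t : R) : 0 <= flat 1 t.
Proof. by rewrite /flat; case: ifP => // _; rewrite hornerC mul1r expR_ge0. Qed.

Lemma flat1_gt0 (t : R) : 0 < t -> 0 < flat 1 t.
Proof. by rewrite /flat => ->; rewrite hornerC mul1r expR_gt0. Qed.

Lemma flat1_eq0 (t : R) : t <= 0 -> flat 1 t = 0.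
Proof. by move=> t0; rewrite /flat ltNge t0. Qed.

(** The usual quotient of flat functions; [-1 * t + 1] has the affine form that [Cn_comp_affine]
    expects. *)
Definition smooth_step (t : R) := flat 1 t * (flat 1 t + flat 1 (-1 * t + 1))^-1.

Let den_gt0 (t : R) : 0 < flat 1 t + flat 1 (-1 * t + 1).
Proof.
have [t0|t0] := ltP 0 t; first by rewrite ltr_pwDl ?flat1_gt0// flat1_ge0.
by rewrite ltr_wpDl ?flat1_ge0// flat1_gt0//; lra.
Qed.

Lemma smooth_step_ge0 (t : R) : 0 <= smooth_step t.
Proof. by rewrite mulr_ge0 ?flat1_ge0// invr_ge0 ltW. Qed.

Lemma smooth_step_le1 (t : R) : smooth_step t <= 1.
Proof. by rewrite /smooth_step ler_pdivrMr// mul1r lerDl flat1_ge0. Qed.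

Lemma smooth_step_eq0 (t : R) : t <= 0 -> smooth_step t = 0.
Proof. by move=> t0; rewrite /smooth_step flat1_eq0// mul0r. Qed.

Lemma smooth_step_eq1 (t : R) : 1 <= t -> smooth_step t = 1.
Proof.
move=> t1; rewrite /smooth_step [X in _ + X]flat1_eq0 ?addr0 ?mulfV// ?gt_eqF ?flat1_gt0//; lra.
Qed.

Lemma Cn_smooth_step n : Cn n smooth_step.
Proof.
apply: CnM; first exact: Cn_flat.
apply: CnV; first by move=> t; rewrite gt_eqF.
by apply: CnD; [exact: Cn_flat|apply: (@Cn_comp_affine _ n (flat 1)); exact: Cn_flat].
Qed.

Lemma derive1_smooth_step_eq0 (t : R) : t < 0 \/ 1 < t -> derive1 smooth_step t = 0.
Proof.
move=> t01; rewrite derive1E.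
have [c Hc] : exists c, \forall s \near t, smooth_step s = cst c s.
  case: t01 => t01; [exists 0|exists 1]; near=> s.
    by apply: smooth_step_eq0; apply: ltW; near: s; exact: lt_nbhsl.
  by apply: smooth_step_eq1; apply: ltW; near: s; exact: lt_nbhsr.
by rewrite (near_eq_derive _ Hc) derive_cst.
Unshelve. all: by end_near. Qed.

Lemma continuous_derive1_smooth_step : continuous (derive1 smooth_step).
Proof.
move=> t; apply: differentiable_continuous; apply/derivable1_diffP.
by have [_ []] := Cn_smooth_step 1.
Qed.

Lemma derive1_smooth_step_bounded : exists2 C, 0 < C & forall t, `|derive1 smooth_step t| <= C.
Proof.
have [M [_ HM]] : bounded_set (derive1 smooth_step @` `[0, 1]).
  apply: compact_bounded; apply: continuous_compact; last exact: segment_compact.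
  by apply: continuous_subspaceT; exact: continuous_derive1_smooth_step.
exists (`|M| + 1) => [|t]; first by rewrite ltr_wpDl.
have [t01|t01] := boolP (0 <= t <= 1).
  apply: HM; first by rewrite (le_lt_trans (ler_norm M))// ltrDl.
  by exists t => //; rewrite /= in_itv.
rewrite derive1_smooth_step_eq0 ?normr0 ?addr_ge0//.
by move: t01; rewrite negb_and -!ltNge => /orP.
Qed.

End smooth_step.

(** * A one-sided approximate identity *)

Section step_kernel.
Context {R : realType}.
Implicit Types (p : R -> R).
Notation mu := (@lebesgue_measure R).

(** The derivative of the smooth step that rises from 0 to 1 on [[x, x + e]]. *)
Definition step_kernel (x e t : R) := e^-1 * derive1 smooth_step (e^-1 * t + - (e^-1 * x)).

Lemma is_derive_smooth_step_affine (x e t : R) :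
  is_derive t (1 : R) (fun t => smooth_step (e^-1 * t + - (e^-1 * x))) (step_kernel x e t).
Proof. by apply: (@is_derive_comp_affine _ smooth_step); exact: Cn_derivable (Cn_smooth_step 0). Qed.

Lemma continuous_step_kernel x e : continuous (step_kernel x e).
Proof.
move=> t; apply: cvgM; first exact: cvg_cst.
apply: (@continuous_comp _ _ _ (fun t => e^-1 * t + - (e^-1 * x)) (derive1 smooth_step)).
  by apply: cvgD; [apply: cvgM; [exact: cvg_cst|exact: cvg_id]|exact: cvg_cst].
exact: continuous_derive1_smooth_step.
Qed.

Lemma step_kernel_eq0 (x e t : R) : 0 < e -> t < x \/ x + e < t -> step_kernel x e t = 0.
Proof.
move=> e0 xt; rewrite /step_kernel derive1_smooth_step_eq0 ?mulr0// -mulrBr.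
case: xt => xt; [left|right].
  by rewrite pmulr_rlt0 ?invr_gt0// subr_lt0.
by rewrite ltr_pdivlMl// mulr1 ltrBrDl.
Qed.

Lemma step_kernel_bounded : exists2 C : R, 0 < C &
  forall x e t, 0 < e -> `|step_kernel x e t| <= C / e.
Proof.
have [C C0 HC] := @derive1_smooth_step_bounded R; exists C => // x e t e0.
by rewrite normrM gtr0_norm ?invr_gt0// mulrC ler_pM2r ?invr_gt0.
Qed.

Lemma integrable_mul_step_kernel p a b x e : 0 < e ->
  mu.-integrable `[a, b] (EFin \o p) ->
  mu.-integrable `[a, b] (EFin \o (fun t => p t * step_kernel x e t)).
Proof.
move=> e0 ip; have [C C0 HC] := step_kernel_bounded.
apply: (integrableMl _ ip) => //.
  by apply: measurable_funTS; apply: continuous_measurable_fun; exact: continuous_step_kernel.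
exists (C / e); split; first exact: num_real.
by move=> M CM t _; exact: le_trans (HC x e t e0) (ltW CM).
Qed.

Lemma Rintegral_step_kernel a b x e : 0 < e -> a <= x -> x + e <= b ->
  (\int[mu]_(t in `[a, b]) step_kernel x e t)%R = 1.
Proof.
move=> e0 ax xb.
rewrite /Rintegral (continuous_FTC2 (F := fun t => smooth_step (e^-1 * t + - (e^-1 * x)))).
- rewrite -EFinB /= smooth_step_eq1 ?smooth_step_eq0 ?subr0// -mulrBr.
    by rewrite pmulr_rle0 ?invr_gt0// subr_le0.
  by rewrite ler_pdivlMl// mulr1 lerBrDl.
- lra.
- by apply: continuous_subspaceT; exact: continuous_step_kernel.
- have cF : continuous (fun t => smooth_step (e^-1 * t + - (e^-1 * x))).
    move=> t; apply: differentiable_continuous; apply/derivable1_diffP.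
    by have [] := is_derive_smooth_step_affine x e t.
  split; first by move=> t _; have [] := is_derive_smooth_step_affine x e t.
    by apply: cvg_at_right_filter; exact: cF.
  by apply: cvg_at_left_filter; exact: cF.
- move=> t _; rewrite derive1E; exact: (@derive_val _ _ _ _ _ _ _ (is_derive_smooth_step_affine x e t)).
Qed.

(** The kernel has integral 1 and is at most C / e, and its support lies in the open ball of radius
    2 e, of length 4 e. The error is thus at most 4 C times the mean of |p - p x| over that ball,
    which tends to 0 at a Lebesgue point. *)
Lemma lebesgue_pt_step_kernel p a b x : a < x < b ->
  mu.-integrable `[a, b] (EFin \o p) -> lebesgue_pt (p \_ `[a, b]) x ->
  forall eta : R, 0 < eta -> exists2 d, 0 < d & forall e, 0 < e < d ->
    `|(\int[mu]_(t in `[a, b]) (p t * step_kernel x e t))%R - p x| <= eta.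
Proof.
move=> /andP[ax xb] ip lx eta eta0; have [C C0 HC] := step_kernel_bounded.
have pE t : t \in `[a, b] -> (p \_ `[a, b]) t = p t.
  by move=> tab; rewrite patchE mem_set.
have c0 : 0 < eta / (4 * C) by rewrite divr_gt0// mulr_gt0.
have [d /= d0 Hd] : \forall r \near (0 : R)^'+,
    (davg (p \_ `[a, b]) x r < (eta / (4 * C))%:E)%E.
  apply: (lx [set y | (y < (eta / (4 * C))%:E)%E]).
  by apply: open_nbhs_nbhs; split; [exact: open_ereal_lt_ereal|rewrite /= lte_fin].
exists (Num.min (d / 2) (Num.min ((x - a) / 2) ((b - x) / 2))).
  by rewrite !lt_min !divr_gt0// subr_gt0.
move=> e /andP[e0]; rewrite !lt_min => /and3P[ed ea eb].
have B : ball x (2 * e) `<=` `[a, b].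
  move=> t; rewrite ball_itv /= !in_itv/= => /andP[]; lra.
have iB : mu.-integrable (ball x (2 * e)) (EFin \o p).
  by apply: integrableS ip => //; exact: measurable_ball.
have -> : p x = (\int[mu]_(t in `[a, b]) (p x * step_kernel x e t))%R.
  rewrite RintegralZl//.
    by rewrite Rintegral_step_kernel ?mulr1//; lra.
  apply: continuous_compact_integrable; first exact: segment_compact.
  by apply: continuous_subspaceT; exact: continuous_step_kernel.
have icst D : measurable D -> (mu D < +oo)%E -> mu.-integrable D (EFin \o cst (p x)).
  move=> mD Doo; apply: measurable_bounded_integrable => //.
  exists `|p x|; split; first exact: num_real.
  by move=> M pM t _ /=; exact: ltW.
have muab : (mu `[a, b] < +oo)%E.
  by rewrite /= lebesgue_measure_itv/=; case: ifP => // _; rewrite -EFinB ltry.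
rewrite -RintegralB//; last 2 first.
- exact: integrable_mul_step_kernel.
- by apply: integrable_mul_step_kernel => //; exact: icst.
have -> : (\int[mu]_(t in `[a, b]) (p t * step_kernel x e t - p x * step_kernel x e t))%R =
    (\int[mu]_(t in ball x (2 * e)) ((p t - p x) * step_kernel x e t))%R.
  rewrite Rintegral_mkcond [RHS]Rintegral_mkcond; congr (Rintegral _ _ _).
  apply/funext => t; rewrite !patchE; case: ifPn => tab; case: ifPn => tb //.
  - by rewrite mulrBl.
  - rewrite step_kernel_eq0 ?mulr0 ?subr0//.
    move: tb; rewrite notin_setE ball_itv /= in_itv/= => tb.
    have [//|xt] := ltP t x; first by left.
    right; rewrite ltNge; apply/negP => te; apply: tb; apply/andP; split; lra.
  - by move: tab; rewrite notin_setE; move/set_mem : tb => /B.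
have mB : measurable (ball x (2 * e) : set (measurableTypeR R)) by exact: measurable_ball.
have e20 : 0 <= 2 * e by rewrite mulr_ge0// ltW.
have muB : (mu (ball x (2 * e)) < +oo)%E.
  by rewrite lebesgue_measure_ball// ltry.
have iD : mu.-integrable (ball x (2 * e)) (EFin \o (fun t => p t - p x)).
  exact: (integrableB mB iB (icst _ mB muB)).
have iDk : mu.-integrable (ball x (2 * e)) (EFin \o (fun t => (p t - p x) * step_kernel x e t)).
  apply: (integrableMl _ iD) => //.
    by apply: measurable_funTS; apply: continuous_measurable_fun; exact: continuous_step_kernel.
  exists (C / e); split; first exact: num_real.
  by move=> M CM t _; exact: le_trans (HC x e t e0) (ltW CM).
apply: le_trans (le_normr_Rintegral _ iDk) _ => //.
apply: (@le_trans _ _ (\int[mu]_(t in ball x (2 * e)) (C / e * `|p t - p x|))%R).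
  apply: le_Rintegral => //.
  - exact: integrable_norm iDk.
  - exact: (integrableZl _ (C / e) (integrable_norm iD)).
  - move=> t _; rewrite normrM mulrC ler_wpM2r//; exact: HC.
rewrite RintegralZl//; last exact: integrable_norm iD.
have {}Hd : (davg (p \_ `[a, b]) x (2 * e) < (eta / (4 * C))%:E)%E.
  apply: Hd; last by rewrite mulr_gt0.
  by rewrite /= sub0r normrN ger0_norm//; lra.
have davgE : davg (p \_ `[a, b]) x (2 * e) =
    ((4 * e)^-1 * \int[mu]_(t in ball x (2 * e)) `|p t - p x|)%:E.
  have e4 : 2 * e *+ 2 = 4 * e by rewrite -mulr_natr; ring.
  rewrite /davg /iavg lebesgue_measure_ball// EFinM inver e4.
  rewrite mulf_eq0 pnatr_eq0/= gt_eqF//; congr (_ * _)%E.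
  rewrite /Rintegral fineK; last first.
    exact: integrable_fin_num (integrable_norm iD).
  apply: eq_integral => t /set_mem tB; transitivity (`|((p \_ `[a, b]) t - (p \_ `[a, b]) x)%:E|%E) => //.
  by rewrite (pE t (B t tB)) pE// in_itv/= (ltW ax) (ltW xb).
move: Hd; rewrite davgE lte_fin ltr_pdivrMl ?mulr_gt0// => /ltW Hd.
have -> : eta = C / e * (4 * e * (eta / (4 * C))).
  by field; rewrite !gt_eqF.
by rewrite ler_pM2l// divr_gt0.
Qed.

End step_kernel.

(** * From a bounded distributional derivative to a Lipschitz estimate *)

Section distr.
Context {R : realType}.
Notation mu := (@lebesgue_measure R).

Let step_diff (x y e t : R) := smooth_step (e^-1 * t + - (e^-1 * x))
  + -1 * smooth_step (e^-1 * t + - (e^-1 * y)).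

Let step_diff_eq0 (x y e t : R) : 0 < e -> x <= y -> t \notin `[x, y + e] ->
  step_diff x y e t = 0.
Proof.
move=> e0 xy; rewrite in_itv/= negb_and -!ltNge /step_diff => /orP[tx|yt].
  rewrite !smooth_step_eq0 ?mulr0 ?addr0// -mulrBr pmulr_rle0 ?invr_gt0//; lra.
by rewrite !smooth_step_eq1 ?mulr1 ?subrr// -mulrBr ler_pdivlMl//; lra.
Qed.

Let step_diff_le (x y e t : R) : 0 < e -> x <= y ->
  `|step_diff x y e t| <= \1_(`[x, y + e]%classic) t.
Proof.
move=> e0 xy; rewrite indicE.
have [txy|txy] := boolP (t \in `[x, y + e]); last first.
  by rewrite step_diff_eq0// normr0.
rewrite mem_set//=.
have := smooth_step_ge0 (e^-1 * t + - (e^-1 * x)); have := smooth_step_le1 (e^-1 * t + - (e^-1 * x)).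
have := smooth_step_ge0 (e^-1 * t + - (e^-1 * y)); have := smooth_step_le1 (e^-1 * t + - (e^-1 * y)).
by rewrite /step_diff ler_norml; lra.
Qed.

Let test_function_step_diff (U : set R) (x y e : R) : 0 < e -> x <= y ->
  `[x, y + e] `<=` U -> test_function U (step_diff x y e).
Proof.
move=> e0 xy xyU; split => [n t|].
  apply: Cn_derivable1n; apply: CnD; first exact: (Cn_comp_affine _ _ (Cn_smooth_step n)).
  by apply: CnM; [exact: Cn_cst|exact: (Cn_comp_affine _ _ (Cn_smooth_step n))].
exists `[x, y + e]%classic; split => // [|t]; first exact: segment_compact.
by move=> /negP; exact: step_diff_eq0.
Qed.

(* The test function is the difference of two smooth steps, from [0] to [1] on
   [[x, x + e]] and on [[y, y + e]]; its derivative is the difference of two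
   approximate identities, at [x] and at [y]. *)
Lemma distr_deriv_step_kernel (U : set R) (P : R -> \bar R) h (K a b x y e : R) :
  is_distributional_derivative U P h -> 0 <= K ->
  {ae mu, forall t, U t -> `|h t| <= K} ->
  `[a, b] `<=` U -> a <= x -> x <= y -> y + e <= b -> 0 < e ->
  `|(\int[mu]_(t in `[a, b]) (fine (P t) * step_kernel x e t))%R -
    (\int[mu]_(t in `[a, b]) (fine (P t) * step_kernel y e t))%R| <= K * (y + e - x).
Proof.
move=> [iP lh Pphi] K0 hK abU ax xy yb e0.
have [mh oU _] := lh.
have mU : measurable (U : set (measurableTypeR R)) by exact: open_measurable.
have xyU : `[x, y + e] `<=` U.
  by move=> t /= txy; apply: abU; move: txy; rewrite /= !in_itv/=; lra.
pose phi := step_diff x y e.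
have tphi : test_function U phi by exact: test_function_step_diff.
have dphi : derive1 phi = (fun t => step_kernel x e t - step_kernel y e t).
  apply: is_derive_derive1E => t.
  have -> : step_kernel x e t - step_kernel y e t =
    step_kernel x e t + ((-1) *: step_kernel y e t + smooth_step (e^-1 * t + - (e^-1 * y)) *: 0).
    by rewrite /GRing.scale/= mulr0 addr0 mulN1r.
  apply: is_deriveD; first exact: is_derive_smooth_step_affine.
  by apply: is_deriveM; exact: is_derive_smooth_step_affine.
have iPab : mu.-integrable `[a, b] P by apply: iP => //; exact: segment_compact.
have mP : measurable_fun `[a, b] P by case/integrableP: iPab.
have ip : mu.-integrable `[a, b] (EFin \o (fine \o P)).
  apply: le_integrable iPab => //; first exact/measurable_EFinP/measurableT_comp.
  by move=> t _ /=; case: (P t) => [r| |]//=; rewrite normr0 leey.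
have ik z : mu.-integrable `[a, b] (EFin \o (fun t => fine (P t) * step_kernel z e t)).
  exact: (@integrable_mul_step_kernel _ (fine \o P)).
rewrite -RintegralB//.
have E : ((\int[mu]_(t in `[a, b]) (fine (P t) * step_kernel x e t - fine (P t) * step_kernel y e t))%R%:E
    = - \int[mu]_(t in U) (h t * phi t)%:E)%E.
  rewrite -(Pphi _ tphi) dphi /Rintegral fineK; last first.
    apply: integrable_fin_num => //.
    exact: (integrableB _ (ik x) (ik y)).
  (* [P] may be infinite on a null set, where [fine] turns it into 0; the integral does not see
     this. *)
  transitivity (\int[mu]_(t in `[a, b])
      (P t * (step_kernel x e t - step_kernel y e t)%:E))%E.
    apply: ae_eq_integral => //.
    - apply/measurable_EFinP; apply: measurable_funB.
        by have /integrableP[/measurable_EFinP] := ik x.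
      by have /integrableP[/measurable_EFinP] := ik y.
    - apply: emeasurable_funM => //; apply/measurable_EFinP/measurable_funTS.
      by apply: measurable_funB; apply: continuous_measurable_fun;
        exact: continuous_step_kernel.
    - apply: ae_mono (integrable_ae _ iPab) _ => // t H /H Pfin.
      by rewrite -[in RHS](fineK Pfin) -EFinM mulrBr.
  rewrite integral_mkcond [RHS]integral_mkcond; congr integral.
  apply/funext => t; rewrite !patchE; case: ifPn => tab; case: ifPn => tU //.
    by move: tU; rewrite notin_setE => -[]; apply: abU; exact: set_mem.
  suff -> : step_kernel x e t - step_kernel y e t = 0 by rewrite mule0.
  move: tab; rewrite notin_setE /= in_itv/= => /negP.
  rewrite negb_and -!ltNge => tab.
  by rewrite !step_kernel_eq0 ?subrr//; case/orP: tab => tab; (left; lra) || (right; lra).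
rewrite -lee_fin -abse_EFin E abseN.
have mphi : measurable_fun setT phi.
  apply: continuous_measurable_fun => t; apply: differentiable_continuous.
  by apply/derivable1_diffP; exact: (tphi.1 0%N).
apply: le_trans (le_abse_integral _ _ _) _ => //.
  apply/measurable_EFinP; apply: measurable_funM => //.
  exact: measurable_funTS.
have m1 D : measurable_fun D (fun t => (\1_(`[x, y + e]%classic) t)%:E : \bar R).
  by apply/measurable_EFinP; exact: measurable_indic.
apply: (@le_trans _ _ (\int[mu]_(t in U) (K%:E * (\1_(`[x, y + e]%classic) t)%:E))%E).
  apply: ae_ge0_le_integral => //.
  - apply: measurableT_comp => //; apply/measurable_EFinP; apply: measurable_funM => //.
    exact: measurable_funTS.
  - by move=> t _; rewrite -EFinM lee_fin mulr_ge0.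
  - by apply: measurable_funeM; exact: m1.
  - apply: ae_mono hK _ => t H Ut; rewrite -EFinM abse_EFin lee_fin normrM.
    by apply: ler_pM => //; [exact: H|exact: step_diff_le].
rewrite ge0_integralZl//; last exact: m1.
rewrite integral_indic// setIidl//.
have muI : mu `[x, y + e]%classic = (y + e - x)%:E.
  have xye : x < y + e by lra.
  by rewrite lebesgue_measure_itv/= lte_fin xye -EFinD.
by rewrite [X in (_ * X)%E]muI -EFinM.
Qed.

(** As the width of the kernels tends to 0, the smoothed values tend to those of [P] at its Lebesgue
    points, and the bound K (y + e - x) to K (y - x). *)
Lemma distr_deriv_lipschitz (U : set R) (P : R -> \bar R) h (K a b x y : R) :
  is_distributional_derivative U P h -> 0 <= K ->
  {ae mu, forall t, U t -> `|h t| <= K} ->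
  `[a, b] `<=` U -> a < x < b -> a < y < b ->
  lebesgue_pt ((fine \o P) \_ `[a, b]) x ->
  lebesgue_pt ((fine \o P) \_ `[a, b]) y ->
  `|fine (P x) - fine (P y)| <= K * `|x - y|.
Proof.
move=> dP K0 hK abU.
wlog xy : x y / x <= y.
  move=> H; have [xy|/ltW yx] := leP x y; first exact: H.
  by move=> axb ayb lx ly; rewrite distrC [`|x - y|]distrC; exact: H.
move=> axb ayb lx ly; rewrite [X in _ * X]distrC (ger0_norm (_ : 0 <= y - x)) ?subr_ge0//.
have iPab : mu.-integrable `[a, b] (EFin \o (fine \o P)).
  have iP : mu.-integrable `[a, b] P by case: dP => + _ _; apply; first exact: segment_compact.
  have /integrableP[mP _] := iP.
  apply: le_integrable iP => //; first exact/measurable_EFinP/measurableT_comp.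
  by move=> t _ /=; case: (P t) => [r| |]//=; rewrite normr0 leey.
apply/ler_addgt0Pr => eta eta0.
have eta30 : 0 < eta / 3 by rewrite divr_gt0.
have [d1 d10 H1] := lebesgue_pt_step_kernel axb iPab lx eta30.
have [d2 d20 H2] := lebesgue_pt_step_kernel ayb iPab ly eta30.
(* The third share of [eta] pays for [K * e]; [K + 1] is positive even when [K = 0]. *)
pose d3 := eta / 3 / (K + 1).
have d30 : 0 < d3 by rewrite divr_gt0// ltr_wpDl.
pose e := Num.min (Num.min d1 d2) (Num.min d3 (b - y)) / 2.
have m0 : 0 < Num.min (Num.min d1 d2) (Num.min d3 (b - y)).
  by rewrite !lt_min d10 d20 d30 subr_gt0/=; case/andP: ayb.
have e0 : 0 < e by rewrite divr_gt0.
have : e < Num.min (Num.min d1 d2) (Num.min d3 (b - y)).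
  by rewrite ltr_pdivrMr// mulr2n mulrDr mulr1 ltrDl.
rewrite !lt_min => /andP[/andP[ed1 ed2] /andP[ed3 eby]].
have Ke : K * e <= eta / 3.
  move: ed3; rewrite ltr_pdivlMr ?ltr_wpDl// => /ltW; apply: le_trans.
  by rewrite mulrC ler_wpM2l ?(ltW e0)// lerDl.
have h1 := H1 e; rewrite e0 ed1 in h1.
have h2 := H2 e; rewrite e0 ed2 in h2.
move: axb ayb => /andP[ax xb] /andP[ay yb].
have ybe : y + e <= b by rewrite -lerBrDl ltW.
have hd := @distr_deriv_step_kernel U P h K a b x y e dP K0 hK abU (ltW ax) xy ybe e0.
rewrite (_ : K * (y + e - x) = K * (y - x) + K * e) in hd; last by ring.
have tri (A B p q k l : R) : l <= eta / 3 -> `|A - B| <= k + l ->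
    `|A - p| <= eta / 3 -> `|B - q| <= eta / 3 -> `|p - q| <= k + eta.
  rewrite !ler_norml; lra.
exact: tri Ke hd (h1 isT) (h2 isT).
Qed.

End distr.

(** * The covering argument *)

Section chain.
Context {R : realType}.
Variables (I : set R) (u m : R -> R) (N g : R).

Definition steep (l r : R) := u r - u l >= g * N * (r - l).
(* [m] is the distribution function of an open set of small measure around an
   exceptional null set; its component intervals may also be used as pieces. *)
Definition filled (l r : R) :=
  forall y z, l <= y -> y <= z -> z <= r -> z - y <= m z - m y.

(* [chain p d e]: [p, e] is a union of consecutive intervals, of which the last
   but one ends at [d]; the next one must start at or after [d], so that no
   point is covered three times. *)
Inductive chain (p : R) : R -> R -> Prop :=
| chain_start e : I p -> I e -> p < e -> steep p e \/ filled p e -> chain p p e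
| chain_steep d e l r : chain p d e -> I l -> I r -> d <= l -> l <= e -> e < r ->
    steep l r -> chain p e r
| chain_filled d e r : chain p d e -> I r -> e < r -> filled e r -> chain p e r.

Lemma chain_ends p d e : chain p d e -> [/\ I p, I d, I e, p <= d & d < e].
Proof.
elim=> [{}e Ip Ie pe _|{}d {}e l r _ [Ip Id Ie pd de] Il Ir dl le er _|
    {}d {}e r _ [Ip Id Ie pd de] Ir er _]; split => //.
  by rewrite (le_trans pd) ?ltW.
by rewrite (le_trans pd) ?ltW.
Qed.

(** Removing pieces from the end of a chain restores the condition [d <= l] under which a steep
    interval with left end [l = x] may be appended. *)
Lemma chain_pop p d e x : chain p d e -> p <= x -> x <= e ->
  exists d' e', [/\ chain p d' e', d' <= x & x <= e'].
Proof.
elim=> [{}e Ip Ie pe h px xe|{}d {}e l r h ih Il Ir dl le er s px xr|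
    {}d {}e r h ih Ir er s px xr].
- by exists p, e; split => //; exact: chain_start.
- have [xe|ex] := leP x e; first exact: ih.
  by exists e, r; split; [exact: (chain_steep h Il)|exact: ltW|].
- have [xe|ex] := leP x e; first exact: ih.
  by exists e, r; split; [exact: (chain_filled h)|exact: ltW|].
Qed.

Hypothesis N0 : 0 <= N.
Hypothesis g1 : g <= 1.
Hypothesis m_nd : {homo m : x y / x <= y}.
Hypothesis u_lip : forall x y, I x -> I y -> x <= y -> `|u y - u x| <= N * (y - x).

(** Appending a steep [[l, r]] counts the overlap [[l, e]] twice, and [u] grows there by at most N
    (e - l): the rate on the overlap becomes g + g - 1. The stretch after [d] is counted at rate [g]
    until a later piece overlaps it. On a filled piece [u] falls at rate at most N, and the increase
    of [m] is at least the length, so 2 N times that increase makes up for the missing rate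
    [g <= 1]. *)
Lemma chain_rise p d e : chain p d e ->
  (2 * g - 1) * N * (d - p) + g * N * (e - d) - 2 * N * (m e - m p) <= u e - u p.
Proof.
have gN : g * N <= N by rewrite ler_piMl.
have drop l r : I l -> I r -> l < r -> filled l r ->
    g * N * (r - l) - 2 * N * (m r - m l) <= u r - u l.
  move=> Il Ir lr /(_ l r (lexx _) (ltW lr) (lexx _)) h.
  have := u_lip Il Ir (ltW lr); rewrite ler_norml => /andP[h1 _].
  have h2 := ler_wpM2l N0 h.
  have h3 : g * N * (r - l) <= N * (r - l) by rewrite ler_wpM2r // subr_ge0 ltW.
  lra.
elim=> [{}e Ip Ie pe|{}d {}e l r h ih Il Ir dl le er s|{}d {}e r h ih Ir er s].
- rewrite subrr mulr0 add0r => -[s|s]; last exact: drop.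
  have := ler_wpM2l N0 (m_nd (ltW pe)); rewrite /steep in s; lra.
- have [_ Id Ie _ de] := chain_ends h.
  have := u_lip Il Ie le; rewrite ler_norml => /andP[_ h1].
  have h2 := ler_wpM2l N0 (m_nd (ltW er)).
  have h3 : 0 <= (N - g * N) * (l - d) by rewrite mulr_ge0 // subr_ge0.
  rewrite /steep in s; lra.
- have [_ Id Ie _ de] := chain_ends h.
  have h1 := drop _ _ Ie Ir er s.
  have h3 : 0 <= (N - g * N) * (e - d) by rewrite mulr_ge0 // subr_ge0 // ltW.
  lra.
Qed.

(** A supremum argument: if no chain reached [b], the supremum of the right ends of chains would lie
    in an interval of the cover, which would extend some chain beyond it. *)
Lemma chain_cover (a b : R) : a <= b ->
  (forall x, a <= x <= b -> exists l r, [/\ I l, I r, l < x < r &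
     steep l r \/ filled l r]) ->
  exists p q, [/\ I p, I q, p <= a, b <= q &
    (2 * g - 1) * N * (q - p) - 2 * N * (m q - m p) <= u q - u p].
Proof.
move=> ab cov.
pose E := [set e | exists p d, chain p d e /\ p <= a].
have extend x : a <= x <= b -> (x = a \/ forall l, l < x -> exists2 e, E e & l < e) ->
    exists2 e, E e & x < e.
  move=> axb xE; have [l [r [Il Ir /andP[lx xr] lr]]] := cov x axb.
  have [la|al] := leP l a.
    exists r => //; exists l, l; split => //.
    by apply: chain_start => //; exact: lt_trans xr.
  case: xE => [xa|/(_ _ lx)[e [p [d [h pa]]] le]].
    by move: lx; rewrite xa ltNge (ltW al).
  have [xe|ex] := ltP x e; first by exists e => //; exists p, d.
  case: lr => lr.
    have [d' [e' [h' d'l le']]] := chain_pop h (le_trans pa (ltW al)) (ltW le).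
    have [xe'|e'x] := ltP x e'; first by exists e' => //; exists p, d'.
    exists r => //; exists p, e'; split => //; apply: (chain_steep h' Il) => //.
    exact: le_lt_trans xr.
  (* A part of a filled interval is filled, so this piece is cut to start exactly at [e]. *)
  exists r => //.
  exists p, e; split => //; apply: (chain_filled h) => //.
    exact: le_lt_trans xr.
  by move=> y z ey yz zr; apply: lr => //; apply: le_trans ey; exact: ltW.
have [e [p [d [h pa]]] be] : exists2 e, E e & b <= e.
  apply: contrapT => /forall2NP noE.
  have Eb e : E e -> e < b by move=> Ee; have [//|/negP] := noE e; rewrite -ltNge.
  have [e Ee ae] : exists2 e, E e & a < e by apply: extend; [rewrite lexx|left].
  have hs : has_sup E by split; [exists e|exists b => y /Eb/ltW].
  have [||y Ey] := extend (sup E).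
  - rewrite (le_trans (ltW ae)) ?ub_le_sup//=; last by case: hs.
    by rewrite ge_sup//; [exists e|move=> y /Eb/ltW].
  - right=> l lE; have [y Ey yl] := sup_gt (ex_intro _ _ Ee) lE.
    by exists y.
  - by rewrite ltNge ub_le_sup//; case: hs.
exists p, e; have [Ip _ Ie pd de] := chain_ends h; split => //.
apply: le_trans (chain_rise h).
have : 0 <= (1 - g) * N * (e - d).
  by rewrite !mulr_ge0 // subr_ge0 // ltW.
lra.
Qed.

End chain.

Section interval.
Context {R : realType}.
Notation mu := (@lebesgue_measure R).

Lemma finite_measure_interval_bounded (J : set R) : is_interval J ->
  (mu J < +oo)%E -> has_ubound J /\ has_lbound J.
Proof.
move=> iJ Joo.
have mJ : measurable (J : set (measurableTypeR R)) by exact: is_interval_measurable.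
have [->|/set0P[x Jx]] := eqVneq J set0; first by split; exists 0 => y.
have len y z : J y -> J z -> y <= z -> z - y <= fine (mu J).
  move=> Jy Jz yz; rewrite -lee_fin fineK ?ge0_fin_numE//.
  have <- : mu `[y, z]%classic = (z - y)%:E.
    move: yz; rewrite le_eqVlt => /predU1P[->|yz].
      by rewrite set_itv1 lebesgue_measure_set1 subrr.
    by rewrite lebesgue_measure_itv/= lte_fin yz EFinB.
  apply: le_measure; rewrite ?inE//.
  by move=> t; rewrite /= in_itv/=; exact: (iJ _ _ Jy Jz).
have m0 : 0 <= fine (mu J) by rewrite fine_ge0.
split; [exists (x + fine (mu J))|exists (x - fine (mu J))] => y Jy.
  have [xy|/ltW yx] := leP x y; first by have := len _ _ Jx Jy xy; lra.
  by rewrite (le_trans yx)// lerDl.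
have [yx|/ltW xy] := leP y x; first by have := len _ _ Jy Jx yx; lra.
by rewrite (le_trans _ xy)// gerBl.
Qed.

Lemma interval_between (J : set R) x : is_interval J -> (mu J < +oo)%E -> J x ->
  exists a b, [/\ a <= x <= b, `]a, b[ `<=` J & J `<=` `[a, b]].
Proof.
move=> iJ Joo Jx; have [uJ lJ] := finite_measure_interval_bounded iJ Joo.
exists (inf J), (sup J).
have JE t : J t -> inf J <= t <= sup J by move=> Jt; rewrite ge_inf// ub_le_sup.
split; first exact: JE.
  by rewrite -interval_bounded_interior//; exact: interior_subset.
by move=> t Jt; rewrite /= in_itv/=; exact: JE.
Qed.

End interval.

(** * Steep intervals from large values of the maximal function *)

Section bounded_derivative.
Context {R : realType}.
Notation mu := (@lebesgue_measure R).
Variables (I : set R) (u f : R -> R) (N : R).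
Hypothesis itvI : is_interval I.
Hypothesis N0 : 0 <= N.
Hypothesis mf : measurable_fun I f.
Hypothesis fN : {ae mu, forall t, I t -> `|f t| <= N}.
Hypothesis uf : forall x y, I x -> I y -> x <= y ->
  u y - u x = (\int[mu]_(t in `]x, y[) f t)%R.

Let mI (J : set R) : is_interval J -> measurable (J : set (measurableTypeR R)).
Proof. by move=> iJ; exact: is_interval_measurable. Qed.

Let integral_abs_le (J : set R) : measurable (J : set (measurableTypeR R)) -> J `<=` I ->
  (\int[mu]_(t in J) `|(f t)%:E| <= N%:E * mu J)%E.
Proof.
move=> mJ JI; rewrite -(integral_cst mu mJ N%:E).
apply: ae_ge0_le_integral => //.
- apply: measurableT_comp => //; apply/measurable_EFinP.
  by apply: measurable_funS mf => //; exact: mI.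
- by apply: (ae_mono fN) => t H Jt; rewrite abse_EFin lee_fin; apply: H; exact: JI.
Qed.

Lemma bounded_derivative_integrable (J : set R) :
  measurable (J : set (measurableTypeR R)) -> J `<=` I ->
  (mu J < +oo)%E -> mu.-integrable J (EFin \o f).
Proof.
move=> mJ JI Joo; apply/integrableP; split.
  by apply/measurable_EFinP; apply: measurable_funS mf => //; exact: mI.
apply: le_lt_trans (integral_abs_le mJ JI) _.
by rewrite lte_mul_pinfty// lee_fin.
Qed.

Let sub_I x y : I x -> I y -> `]x, y[ `<=` I.
Proof.
move=> Ix Iy t; rewrite /= in_itv/= => /andP[xt ty].
by apply: (itvI Ix Iy); rewrite !ltW.
Qed.

Let mu_oo x y : x <= y -> mu `]x, y[%classic = (y - x)%:E.
Proof.
rewrite le_eqVlt => /predU1P[<-|xy]; first by rewrite set_itvoo0 measure0 subrr.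
by rewrite lebesgue_measure_itv/= lte_fin xy EFinB.
Qed.

Lemma bounded_derivative_lipschitz x y : I x -> I y -> x <= y ->
  `|u y - u x| <= N * (y - x).
Proof.
move=> Ix Iy xy; rewrite uf//.
have mxy : measurable (`]x, y[%classic : set (measurableTypeR R)) by exact: measurable_itv.
have ixy : mu.-integrable `]x, y[ (EFin \o f).
  by apply: bounded_derivative_integrable => //; [exact: sub_I|rewrite mu_oo// ltry].
rewrite -lee_fin /Rintegral -abse_EFin fineK; last exact: integrable_fin_num ixy.
apply: le_trans (le_abse_integral mu mxy _) _; first by case/integrableP: ixy.
by apply: le_trans (integral_abs_le mxy (sub_I Ix Iy)) _; rewrite mu_oo.
Qed.

(** The interval [J] may have [x] as an end point, while the cover needs [x] strictly inside. As the
    average exceeds [c * N] strictly, the ends can be moved a little. *)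
Lemma maximal_on_steep (c : R) x : I° x -> 0 <= c -> c <= 1 ->
  ((c * N)%:E < maximal_on I f^\+%R x)%E ->
  exists l r, [/\ I l, I r, l < x < r & steep u N (2 * c - 1) l r].
Proof.
move=> Iox c0 c1 /ereal_sup_gt[_ [J [iJ JI Jx /andP[J0 Joo]] <-]] cJ.
have [a [b [/andP[ax xb] abJ Jab]]] := interval_between iJ Joo Jx.
have mJ := mI iJ.
have ab : a <= b by exact: le_trans xb.
have muJ : mu J = (b - a)%:E.
  apply/eqP; rewrite eq_le; apply/andP; split.
    apply: (@le_trans _ _ (mu `[a, b]%classic)).
      by apply: le_measure; rewrite ?inE//; exact: measurable_itv.
    rewrite lebesgue_measure_itv/= lte_fin.
    by case: ifP => // _; rewrite lee_fin subr_ge0.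
  by rewrite -mu_oo//; apply: le_measure; rewrite ?inE//; exact: measurable_itv.
have ab0 : 0 < b - a by rewrite -lte_fin -muJ.
have iJf := bounded_derivative_integrable mJ JI Joo.
have absp t : `|(f^\+%R t)%:E|%E = (f^\+%R t)%:E.
  by rewrite abse_EFin ger0_norm// funrpos_ge0.
have posabs t : f^\+%R t <= `|f t|.
  by rewrite /funrpos ge_max ler_norm normr_ge0.
have ip (D : set R) : measurable (D : set (measurableTypeR R)) -> D `<=` I -> (mu D < +oo)%E ->
    mu.-integrable D (EFin \o f^\+%R).
  move=> mD DI Doo; have iD := bounded_derivative_integrable mD DI Doo.
  apply: le_integrable iD => //.
    apply/measurable_EFinP/measurable_funrpos; apply: measurable_funS mf => //; exact: mI.
  by move=> t _; rewrite lee_fin ger0_norm// funrpos_ge0.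
pose A := (\int[mu]_(t in J) f^\+%R t)%R.
have AJ : c * N * (b - a) < A.
  have iE : iavg f^\+%R J = ((b - a)^-1 * A)%:E.
    rewrite /iavg muJ inver gt_eqF// EFinM; congr (_ * _)%E.
    rewrite /A /Rintegral fineK; last exact: integrable_fin_num (ip J mJ JI Joo).
    by apply: eq_integral => t _; exact: absp.
  by move: cJ; rewrite iE lte_fin ltr_pdivlMl// mulrC.
(* Moving each end by at most [eta] loses at most 2 N eta of the integral and raises the target c N
   (r - l) by at most 2 N eta; the summand 1 leaves a positive denominator when [N = 0]. *)
pose eta := (A - c * N * (b - a)) / (4 * N + 1).
have N41 : 0 < 4 * N + 1 by rewrite ltr_wpDl// mulr_ge0.
have eta0 : 0 < eta by rewrite divr_gt0// subr_gt0.
have [d /= d0 dI] : nbhs x I by exact: Iox.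
have dI' t : `|x - t| < d -> I t by exact: dI.
pose dl := Num.min eta (d / 2).
have dl0 : 0 < dl by rewrite lt_min eta0 divr_gt0.
have dleta : dl <= eta by rewrite ge_min lexx.
have dld : dl <= d / 2 by rewrite ge_min lexx orbT.
(* If [x] is the left end of [J], move outwards, which stays in [I] because [x] is interior to it;
   otherwise move inwards, staying in [J]. The right end is symmetric. *)
have [l [Il lx al]] : exists l, [/\ I l, l < x & a - eta <= l <= a + eta].
  move: ax; rewrite le_eqVlt => /predU1P[axE|ax].
    exists (x - dl); split; [|lra|apply/andP; split; lra].
    by apply: dI'; rewrite opprB addrC subrK gtr0_norm//; lra.
  pose k := Num.min eta ((x - a) / 2).
  have k0 : 0 < k by rewrite lt_min eta0 divr_gt0// subr_gt0.
  have keta : k <= eta by rewrite ge_min lexx.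
  have kx : k <= (x - a) / 2 by rewrite ge_min lexx orbT.
  exists (a + k); split; [|lra|apply/andP; split; lra].
  by apply/JI/abJ; rewrite /= in_itv/=; apply/andP; split; lra.
have [r [Ir xr rb]] : exists r, [/\ I r, x < r & b - eta <= r <= b + eta].
  move: xb; rewrite le_eqVlt => /predU1P[xbE|xb].
    exists (x + dl); split; [|lra|apply/andP; split; lra].
    by apply: dI'; rewrite opprD addrA subrr sub0r normrN gtr0_norm//; lra.
  pose k := Num.min eta ((b - x) / 2).
  have k0 : 0 < k by rewrite lt_min eta0 divr_gt0// subr_gt0.
  have keta : k <= eta by rewrite ge_min lexx.
  have kx : k <= (b - x) / 2 by rewrite ge_min lexx orbT.
  exists (b - k); split; [|lra|apply/andP; split; lra].
  by apply/JI/abJ; rewrite /= in_itv/=; apply/andP; split; lra.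
exists l, r; split => //; first by rewrite lx xr.
have lr : l <= r by rewrite ltW// (lt_trans lx).
have mlr : measurable (`]l, r[%classic : set (measurableTypeR R)) by exact: measurable_itv.
have lrI := sub_I Il Ir.
have lroo : (mu `]l, r[%classic < +oo)%E by rewrite mu_oo// ltry.
have ilr := bounded_derivative_integrable mlr lrI lroo.
have iplr := ip _ mlr lrI lroo.
pose B := (\int[mu]_(t in `]l, r[) f^\+%R t)%R.
have AB : A <= B + N * (2 * eta).
  have mD : measurable (J `\` `]l, r[ : set (measurableTypeR R)) by exact: measurableD.
  have DI : J `\` `]l, r[ `<=` I by move=> t [/JI].
  have muD : (mu (J `\` `]l, r[) <= (2 * eta)%:E)%E.
    have mitv y : mu `[y, y + eta]%classic = eta%:E.
      rewrite lebesgue_measure_itv/= lte_fin ltrDl eta0.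
      by rewrite -EFinB addrAC subrr add0r.
    rewrite mulr_natl mulr2n EFinD -{1}(mitv a) -(mitv (b - eta)).
    apply: le_trans (measureU2 mu (measurable_itv _) (measurable_itv _)).
    apply: le_measure; rewrite ?inE//; first by apply: measurableU; exact: measurable_itv.
    move=> t [/Jab]; rewrite /= !in_itv/= => /andP[at_ tb] /negP.
    rewrite negb_and -!leNgt => /orP[tl|rt]; [left|right]; lra.
  have Doo : (mu (J `\` `]l, r[) < +oo)%E by rewrite (le_lt_trans muD)// ltry.
  have pfin D : measurable (D : set (measurableTypeR R)) -> D `<=` I -> (mu D < +oo)%E ->
      (\int[mu]_(t in D) (f^\+%R t)%:E = (\int[mu]_(t in D) f^\+%R t)%R%:E)%E.
    move=> mD' D'I D'oo; rewrite /Rintegral fineK//.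
    exact: integrable_fin_num (ip _ mD' D'I D'oo).
  have Dle : ((\int[mu]_(t in J `\` `]l, r[) f^\+%R t)%R <= N * (2 * eta))%R.
    rewrite -lee_fin -pfin//.
    apply: (@le_trans _ _ (N%:E * mu (J `\` `]l, r[))%E); last first.
      by rewrite EFinM lee_wpmul2l.
    apply: le_trans (integral_abs_le mD DI); apply: ge0_le_integral => //.
    - by move=> t _; rewrite lee_fin funrpos_ge0.
    - by case/integrableP: (ip _ mD DI Doo).
    - by apply: measurableT_comp => //; case/integrableP: (bounded_derivative_integrable mD DI Doo).
    - by move=> t _; rewrite abse_EFin lee_fin.
  apply: le_trans (lerD (lexx B) Dle); rewrite -lee_fin EFinD -!pfin//.
  have mU : measurable (`]l, r[ `|` (J `\` `]l, r[) : set (measurableTypeR R)).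
    exact: measurableU.
  have UI : `]l, r[ `|` (J `\` `]l, r[) `<=` I by move=> t [/lrI|/DI].
  have Uoo : (mu (`]l, r[ `|` (J `\` `]l, r[)) < +oo)%E.
    by apply: le_lt_trans (measureU2 mu mlr mD) _; rewrite lte_add_pinfty.
  have mpU : measurable_fun (`]l, r[ `|` (J `\` `]l, r[)) (EFin \o f^\+%R).
    by case/integrableP: (ip _ mU UI Uoo).
  rewrite -ge0_integral_setU//.
  - apply: ge0_subset_integral => //.
      by move=> t _; rewrite lee_fin funrpos_ge0.
    by move=> t Jt; have [?|?] := pselect (`]l, r[%classic t); [left|right].
  - by move=> t _; rewrite lee_fin funrpos_ge0.
  - by apply/disj_set2P; rewrite setDE setICA setICr setI0.
have CB : 2 * B - N * (r - l) <= u r - u l.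
  rewrite uf//.
  have -> : (\int[mu]_(t in `]l, r[) f t)%R =
      (\int[mu]_(t in `]l, r[) (2 * f^\+%R t - `|f t|))%R.
    apply: eq_Rintegral => t _; rewrite /funrpos.
    have [f0|f0] := leP 0 (f t); first by rewrite ger0_norm//; lra.
    by rewrite ltr0_norm//; lra.
  have i2 : mu.-integrable `]l, r[ (EFin \o (fun t => 2 * f^\+%R t)).
    exact: (integrableZl _ 2 iplr).
  rewrite RintegralB//; last exact: integrable_norm ilr.
  rewrite RintegralZl// lerD2l lerN2 -lee_fin.
  have -> : ((\int[mu]_(t in `]l, r[) `|f t|)%R)%:E = (\int[mu]_(t in `]l, r[) `|(f t)%:E|)%E.
    by rewrite /Rintegral fineK//; exact: integrable_fin_num (integrable_norm ilr).
  by rewrite EFinM -mu_oo//; exact: integral_abs_le.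
have eA : eta * (4 * N + 1) = A - c * N * (b - a) by rewrite divfK// gt_eqF.
have cN : 0 <= c * N by rewrite mulr_ge0.
have h1 : c * N * (r - l) <= c * N * (b - a + 2 * eta).
  by rewrite ler_wpM2l//; lra.
have h2 : c * N * (2 * eta) <= N * (2 * eta).
  by apply: ler_wpM2r; [rewrite mulr_ge0// ltW|rewrite ler_piMl].
move: CB; rewrite /steep; clearbody A B eta; lra.
Qed.

End bounded_derivative.

(** * The increase of the function over a window *)

Section rise.
Context {R : realType}.
Notation mu := (@lebesgue_measure R).

Lemma distribution_function_open (O : set R) (e : R) : open O -> (mu O < e%:E)%E ->
  exists m : R -> R, [/\ {homo m : x y / x <= y},
    forall x y, m y - m x <= e &
    forall l r, `]l, r[ `<=` O -> filled m l r].
Proof.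
move=> oO Oe.
have mO : measurable (O : set (measurableTypeR R)) by exact: open_measurable.
pose H x := O `&` `]-oo, x]%classic.
have mH x : measurable (H x : set (measurableTypeR R)).
  by apply: measurableI => //; exact: measurable_itv.
have Hle x : (mu (H x) <= mu O)%E by apply: le_measure; rewrite ?inE//; exact: subIsetl.
have Hfin x : mu (H x) \is a fin_num.
  rewrite ge0_fin_numE//; apply: le_lt_trans (Hle x) (lt_trans Oe _); exact: ltry.
exists (fun x => fine (mu (H x))); split.
- move=> x y xy; apply: fine_le => //; apply: le_measure; rewrite ?inE//.
  move=> t [Ot]; rewrite /= !in_itv/= => tx; split => //.
  by rewrite /= in_itv/= (le_trans tx).
- move=> x y; have : fine (mu (H y)) <= e.
    by rewrite -lee_fin fineK// (le_trans (Hle y))// ltW.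
  have : 0 <= fine (mu (H x)) by rewrite fine_ge0.
  lra.
- move=> l r lrO y z ly yz zr; rewrite lerBrDr -lee_fin EFinD !fineK//.
  move: yz; rewrite le_eqVlt => /predU1P[->|yz]; first by rewrite subrr add0e.
  have <- : mu `]y, z[%classic = (z - y)%:E.
    by rewrite lebesgue_measure_itv/= lte_fin yz EFinB.
  rewrite addeC -measureU//.
  + apply: le_measure; rewrite ?inE//.
      by apply: measurableU => //; exact: measurable_itv.
    move=> t [[Ot]|]; rewrite /= !in_itv/= => ht.
      by split => //; rewrite /= in_itv/= (le_trans ht)// ltW.
    have /andP[yt tz] := ht; split; last by rewrite /= in_itv/= ltW.
    by apply: lrO; rewrite /= in_itv/= (le_lt_trans ly yt) (lt_le_trans tz zr).
  + apply/seteqP; split => // t [[_]]; rewrite /= !in_itv/= => ty /andP[yt _].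
    by move: yt; rewrite ltNge ty.
Qed.

(** The cover with slope parameter g = 2 c - 1, for which 2 g - 1 = 4 c - 3. The open set [W] around
    the exceptional null set costs at most 2 N e, which the choice of [e] keeps below [eta]. *)
Lemma maximal_on_rise (I : set R) (u f : R -> R) (N U c a b : R) :
  is_interval I -> 0 <= N -> measurable_fun I f ->
  {ae mu, forall t, I t -> `|f t| <= N} ->
  (forall x y, I x -> I y -> x <= y -> u y - u x = (\int[mu]_(t in `]x, y[) f t)%R) ->
  (forall x, I x -> `|u x| <= U) ->
  3 / 4 <= c <= 1 -> a <= b -> `[a, b] `<=` I° ->
  {ae mu, forall t, a <= t <= b -> ((c * N)%:E < maximal_on I f^\+%R t)%E} ->
  (4 * c - 3) * N * (b - a) <= 2 * U.
Proof.
move=> itvI N0 mf fN uf uU /andP[c34 c1] ab abI [Z [mZ Z0 cZ]].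
apply/ler_addgt0Pr => eta eta0.
pose e := eta / (2 * N + 1).
have e0 : 0 < e by rewrite divr_gt0// ltr_wpDl// mulr_ge0.
have Zoo : (mu Z < +oo)%E by rewrite Z0.
have [W [oW ZW We]] := lebesgue_regularity_outer mZ Zoo e0.
have {}We : (mu W < e%:E)%E.
  have mW : measurable (W : set (measurableTypeR R)) by exact: open_measurable.
  apply: le_lt_trans We; rewrite -[leRHS]add0e -Z0.
  have mWZ := measurableD mW mZ.
  apply: le_trans (measureU2 mu mZ mWZ); apply: le_measure; rewrite ?inE//.
    exact: measurableU.
  by move=> t Ot; have [?|?] := pselect (Z t); [left|right].
have [m [m_nd me mW]] := distribution_function_open oW We.
have lip := bounded_derivative_lipschitz itvI N0 mf fN uf.
have [||p [q [Ip Iq pa bq]]] := @chain_cover R I u m N (2 * c - 1) N0 _ m_nd lip a b ab.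
- lra.
- move=> x xab; have Iox : I° x by apply: abI; rewrite /= in_itv.
  have [cx|cx] := pselect ((c * N)%:E < maximal_on I f^\+%R x)%E.
    have c0 : 0 <= c by lra.
    have [l [r [Il Ir lxr s]]] := maximal_on_steep itvI N0 mf fN uf Iox c0 c1 cx.
    by exists l, r; split => //; left.
  (* A point where the lower bound fails lies in the null set, hence in [W], and a small interval
     around it within [W] is filled. *)
  have Wx : W x by apply/ZW/cZ => /(_ xab).
  have [d /= d0 dI] : nbhs x (W `&` I).
    by apply: filterI; [exact: open_nbhs_nbhs|exact: Iox].
  have dOI t : `|x - t| < d -> W t /\ I t by exact: dI.
  exists (x - d / 2), (x + d / 2); split.
  + by apply: (dOI _ _).2; rewrite opprB addrC subrK gtr0_norm; lra.
  + by apply: (dOI _ _).2; rewrite opprD addrA subrr sub0r normrN gtr0_norm; lra.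
  + by apply/andP; split; lra.
  + right; apply: mW => t; rewrite /= in_itv/= => /andP[h1 h2].
    by apply: (dOI _ _).1; rewrite ltr_norml; apply/andP; split; lra.
have upq : u q - u p <= 2 * U.
  by have := uU _ Ip; have := uU _ Iq; rewrite !ler_norml; lra.
have Ne : 2 * N * (m q - m p) <= eta.
  apply: (@le_trans _ _ (2 * N * e)); first by rewrite ler_wpM2l// mulr_ge0.
  by rewrite /e mulrCA ger_pMr// ler_pdivrMr ?ltr_wpDl ?mulr_ge0// mul1r lerDl.
(* The chain may overshoot [[a, b]]; this only helps, because [c >= 3 / 4] makes the rate
   nonnegative. *)
have Nab : (2 * (2 * c - 1) - 1) * N * (b - a) <= (2 * (2 * c - 1) - 1) * N * (q - p).
  by apply: ler_wpM2l; [rewrite mulr_ge0//; lra|lra].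
lra.
Qed.

End rise.

(** * The Landau inequality *)

Section core.
Context {R : realType}.
Notation mu := (@lebesgue_measure R).

(** |g x| is at most the mean of |g| plus the mean of |g - g x| over a small ball, and the latter
    tends to 0. *)
Lemma lebesgue_pt_le_maximal_on (I : set R) (g : R -> R) (a b x : R) :
  `[a, b] `<=` I -> a < x < b -> mu.-integrable `[a, b] (EFin \o g) ->
  lebesgue_pt (g \_ `[a, b]) x -> ((g x)%:E <= maximal_on I g x)%E.
Proof.
move=> abI /andP[ax xb] ig lx; apply/lee_addgt0Pr => e e0.
have [d /= d0 Hd] : \forall r \near (0 : R)^'+, (davg (g \_ `[a, b]) x r < e%:E)%E.
  apply: (lx [set y | (y < e%:E)%E]).
  by apply: open_nbhs_nbhs; split; [exact: open_ereal_lt_ereal|rewrite /= lte_fin].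
pose r := Num.min d (Num.min (x - a) (b - x)) / 2.
have m0 : 0 < Num.min d (Num.min (x - a) (b - x)) by rewrite !lt_min d0 !subr_gt0 ax.
have r0 : 0 < r by rewrite divr_gt0.
have : r < Num.min d (Num.min (x - a) (b - x)).
  by rewrite ltr_pdivrMr// mulr2n mulrDr mulr1 ltrDl.
rewrite !lt_min => /and3P[rd ra rb].
have B : ball x r `<=` `[a, b].
  by move=> t; rewrite ball_itv /= !in_itv/= => /andP[]; lra.
have mB : measurable (ball x r : set (measurableTypeR R)) by exact: measurable_ball.
have muB : mu (ball x r) = (r *+ 2)%:E by rewrite lebesgue_measure_ball// ltW.
have r20 : 0 < r *+ 2 by rewrite pmulrn_lgt0.
have JM : (iavg g (ball x r) <= maximal_on I g x)%E.
  apply: ereal_sup_ubound; exists (ball x r) => //; split.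
  - by rewrite ball_itv; exact: interval_is_interval.
  - by move=> t /B/abI.
  - exact: ballxx.
  - by rewrite [X in (0 < X < _)%E]muB lte_fin r20 ltry.
apply: le_trans (leeD JM (lexx _)).
have {}Hd : (davg (g \_ `[a, b]) x r <= e%:E)%E.
  by apply/ltW/Hd => //; rewrite /= sub0r normrN gtr0_norm.
apply: le_trans (leeD (lexx _) Hd).
have iB : mu.-integrable (ball x r) (EFin \o g) by apply: integrableS ig.
have [mg _] := integrableP _ _ _ iB.
have gE t : t \in `[a, b] -> (g \_ `[a, b]) t = g t.
  by move=> tab; rewrite patchE mem_set.
have dE : davg (g \_ `[a, b]) x r =
    ((r *+ 2)^-1%:E * \int[mu]_(t in ball x r) `|(g t - g x)%:E|)%E.
  rewrite /davg /iavg muB inver gt_eqF//; congr (_ * _)%E.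
  apply: eq_integral => t /set_mem tB.
  transitivity (`|((g \_ `[a, b]) t - (g \_ `[a, b]) x)%:E|%E) => //.
  by rewrite (gE t (B t tB)) gE// in_itv/= (ltW ax) (ltW xb).
rewrite dE /iavg muB inver gt_eqF// -ge0_muleDr; last 2 first.
- by apply: integral_ge0 => t _.
- by apply: integral_ge0 => t _.
have mgx : measurable_fun (ball x r) (fun t => (g t - g x)%:E).
  by apply/measurable_EFinP; apply: measurable_funB => //; exact/measurable_EFinP.
rewrite -ge0_integralD//; last 2 first.
- exact: measurableT_comp.
- exact: measurableT_comp.
apply: (@le_trans _ _ `|g x|%:E); first by rewrite lee_fin ler_norm.
rewrite lee_pdivlMl// -EFinM.
have <- : (\int[mu]_(t in ball x r) cst `|g x|%:E t = (r *+ 2 * `|g x|)%:E)%E.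
  by rewrite integral_cst// [X in (_ * X)%E]muB -EFinM mulrC.
apply: ge0_le_integral => //.
- by move=> t _; rewrite lee_fin.
- by apply: emeasurable_funD; exact: measurableT_comp.
- move=> t _; rewrite -EFinD lee_fin [X in _ <= _ + X]distrC.
  by have := ler_normD (g t) (g x - g t); rewrite addrC subrK.
Qed.

End core.

(** * Choosing a starting point and its window *)

Section landau.
Context {R : realType}.
Notation mu := (@lebesgue_measure R).

(** The segments with rational ends inside [V] are countably many and cover it, so [E] cannot be
    negligible on all of them. Compactness of the segment leaves room for windows around its
    points. *)
Lemma nonnegligible_segment (V E : set R) : open V -> ~ mu.-negligible (E `&` V) ->
  exists a b, [/\ a <= b, `[a, b] `<=` V & ~ mu.-negligible (E `&` `[a, b])].
Proof.
move=> oV; apply: contra_notP => /forallNP H.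
pose F (n : nat) : set R := if unpickle n is Some (p, q) then
   [set t | [/\ E t, (ratr p : R) <= t <= ratr q & `[ratr p, ratr q] `<=` V]] else set0.
apply: (@negligibleS _ _ _ mu (\bigcup_n F n)).
  move=> t [Et Vt].
  have [d /= d0 dV] : nbhs t V by exact: open_nbhs_nbhs.
  have td : t - d < t by rewrite ltrBlDr ltrDl.
  have dt : t < t + d by rewrite ltrDl.
  have [p] := rat_in_itvoo td; rewrite in_itv/= => /andP[tp pt].
  have [q] := rat_in_itvoo dt; rewrite in_itv/= => /andP[tq qt].
  have [n nE] : exists n, unpickle n = Some (p, q).
    by exists (pickle (p, q)); exact: pickleK.
  exists n => //; rewrite /F nE; split => //.
    by rewrite !ltW.
  move=> y; rewrite /= in_itv/= => /andP[py yq]; apply: dV => /=.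
  have := lt_le_trans tp py; have := le_lt_trans yq qt; clear.
  by rewrite ltr_norml; lra.
apply: negligible_bigcup => n; rewrite /F; case: unpickle => [[p q]|]; last first.
  exact: negligible_set0.
have [pqV|pqV] := pselect (`[ratr p, ratr q] `<=` V); last first.
  by apply: (@negligibleS _ _ _ mu set0); [move=> t []|exact: negligible_set0].
have [pq|qp] := leP (ratr p : R) (ratr q); last first.
  apply: (@negligibleS _ _ _ mu set0); last exact: negligible_set0.
  by move=> t [_ /andP[pt tq] _]; move: qp; rewrite ltNge (le_trans pt).
have := H (ratr p) => /forallNP/(_ (ratr q)) => nH.
apply: contrapT => nneg; apply: nH; split => // neg; apply: nneg.
by apply: negligibleS neg => t [Et ptq _]; split => //=; rewrite in_itv.
Qed.

Lemma nonnegligible_ae (E : set R) (P : R -> Prop) :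
  ~ mu.-negligible E -> {ae mu, forall t, P t} -> exists t, E t /\ P t.
Proof.
move=> nE aeP; apply: contrapT => /forallNP H; apply: nE.
by apply: negligibleS aeP => t Et Pt; apply: (H t).
Qed.

(** The segment [[a', b']] is fixed before the starting point, because the Lebesgue points, and with
    them the exceptional null set, are taken relative to it; it must contain the windows of all
    candidates in [[al, be]]. *)
Lemma maximal_on_landau (I : set R) (u f h : R -> R) (N U K s tau : R) :
  is_interval I -> 0 < N -> 0 <= K -> K * s <= N / 8 -> measurable_fun I f ->
  {ae mu, forall t, I t -> `|f t| <= N} ->
  (forall x y, I x -> I y -> x <= y -> u y - u x = (\int[mu]_(t in `]x, y[) f t)%R) ->
  (forall x, I x -> `|u x| <= U) ->
  ~ mu.-negligible ([set t | N - N / 64 < f t] `&` I°) ->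
  is_distributional_derivative I° (maximal_on I f^\+%R) h ->
  {ae mu, forall t, I° t -> `|h t| <= K} ->
  (forall al be, al <= be -> `[al, be] `<=` I° -> exists a' b',
    [/\ `[a', b'] `<=` I°, a' < al, be < b' & forall x, al <= x <= be ->
      exists a, [/\ a' < a, a + tau < b', x - s <= a & a + tau <= x + s]]) ->
  0 <= tau -> 3 / 8 * N * tau <= 2 * U.
Proof.
move=> itvI N0 K0 Ks mf fN uf uU nneg dP hK window tau0.
have [al [be [albe abI {}nneg]]] := nonnegligible_segment (open_interior I) nneg.
have [a' [b' [ab'I a'al beb' {}window]]] := window al be albe abI.
have IoI : I° `<=` I by exact: interior_subset.
have m' : measurable (`[a', b']%classic : set (measurableTypeR R)) by exact: measurable_itv.
have iP : mu.-integrable `[a', b'] (maximal_on I f^\+%R).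
  by case: dP => + _ _; apply => //; exact: segment_compact.
have [mP _] := integrableP _ _ _ iP.
have ip : mu.-integrable `[a', b'] (EFin \o (fine \o maximal_on I f^\+%R)).
  apply: le_integrable iP => //; first exact/measurable_EFinP/measurableT_comp.
  by move=> t _ /=; case: (maximal_on _ _ _) => [r| |]//=; rewrite normr0 leey.
have muab : (mu `[a', b']%classic < +oo)%E.
  by rewrite lebesgue_measure_itv/=; case: ifP => // _; rewrite -EFinB ltry.
have mfpos : measurable_fun `[a', b'] f^\+%R.
  apply: measurable_funrpos; apply: measurable_funS mf.
    exact: is_interval_measurable.
  by move=> t /ab'I/IoI.
have ifpos : mu.-integrable `[a', b'] (EFin \o f^\+%R).
  apply/integrableP; split; first exact/measurable_EFinP.
  apply: (@le_lt_trans _ _ (\int[mu]_(t in `[a', b']) cst N%:E t)%E).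
    apply: ae_ge0_le_integral => //.
    - by apply: measurableT_comp => //; exact/measurable_EFinP.
    - by move=> t _; rewrite lee_fin ltW.
    - apply: (ae_mono fN) => t H /ab'I/IoI/H ft.
      rewrite abse_EFin lee_fin ger0_norm ?funrpos_ge0// (le_trans _ ft)//.
      by rewrite /funrpos ge_max ler_norm normr_ge0.
  by rewrite integral_cst// lte_mul_pinfty// lee_fin ltW.
have lebp := lebesgue_differentiation (integrable_locally_restrict m' ip).
have lebf := lebesgue_differentiation (integrable_locally_restrict m' ifpos).
have Pfin := integrable_ae m' iP.
have good : {ae mu, forall t, [/\ lebesgue_pt ((fine \o maximal_on I f^\+%R) \_ `[a', b']) t,
     lebesgue_pt (f^\+%R \_ `[a', b']) t &
    `[a', b']%classic t -> maximal_on I f^\+%R t \is a fin_num]}.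
  by apply: (ae_mono (ae_and (ae_and lebp lebf) Pfin)) => t [[lpt lft] fint]; split.
(* [x0] is a Lebesgue point of [f^\+], so the maximal function dominates [f^\+] there, and one of
   the maximal function itself, so the Lipschitz estimate can start from it. *)
have [x0 [[/= fx0 x0ab] [lp0 lf0 fin0]]] := nonnegligible_ae nneg good.
rewrite in_itv/= in x0ab.
have x0ab' : a' < x0 < b' by lra.
have [a [a'a tb' sa as_]] := window x0 x0ab.
have Px0 : N - N / 64 < fine (maximal_on I f^\+%R x0).
  have ab'I' : `[a', b'] `<=` I by move=> t /ab'I/IoI.
  have := lebesgue_pt_le_maximal_on ab'I' x0ab' ifpos lf0.
  rewrite -[in X in (_ <= X)%E](fineK (fin0 _)); last by rewrite /= in_itv/= !ltW//; lra.
  rewrite lee_fin; apply: lt_le_trans; rewrite /funrpos.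
  by rewrite lt_max fx0.
clear lebp lebf Pfin ifpos mfpos muab ip mP iP m' window nneg fin0.
(* Here c = 27/32 = 54/64, just below the 55/64 that remains after losing 1/64 and 1/8. *)
have -> : 3 / 8 = 4 * (27 / 32) - 3 :> R by lra.
have -> : tau = (a + tau) - a by lra.
apply: (maximal_on_rise itvI (ltW N0) mf fN uf uU).
- lra.
- lra.
- by move=> t; rewrite /= in_itv/= => ht; apply: ab'I; rewrite /= in_itv/=; lra.
apply: (ae_mono good) => t [lpt _ fint] tab.
have tab' : a' < t < b' by lra.
rewrite -(fineK (fint _)); last by rewrite /= in_itv/=; lra.
rewrite lte_fin.
have := distr_deriv_lipschitz dP K0 hK ab'I tab' x0ab' lpt lp0.
have : K * `|t - x0| <= K * s.
  by apply: ler_wpM2l => //; rewrite ler_norml; lra.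
move: (K * `|t - x0|) (K * s) Ks => k1 k2 Ks k12.
rewrite ler_norml => /andP[h1 h2]; lra.
Qed.

End landau.

(** * Essential suprema, and the derivative on the whole interval *)

Section assembly.
Context {R : realType}.
Notation mu := (@lebesgue_measure R).

Lemma Linfty_normE (I : set R) (f : R -> R) :
  Linfty_norm I f = ess_sup mu (abse \o ((EFin \o f) \_ I)).
Proof.
have T0 : (0 < mu setT)%E.
  by rewrite -set_itvNyy lebesgue_measure_itv/= addye// ltry.
(* The norm of exponent [+oo] is the essential supremum only on a space of positive measure, hence
   [T0]. *)
by rewrite /Linfty_norm Lnorm.unlock; case: ifP => // /negP[].
Qed.

Lemma Linfty_norm_le (I : set R) (f : R -> R) (M : R) : 0 <= M ->
  ((Linfty_norm I f <= M%:E)%E <-> {ae mu, forall t, I t -> `|f t| <= M}).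
Proof.
move=> M0; rewrite Linfty_normE; split=> [/ess_supP|] H.
  apply: (ae_mono H) => t /=; rewrite patchE => + It.
  by rewrite mem_set//= lee_fin.
apply/ess_supP; apply: (ae_mono H) => t /= {}H; rewrite patchE.
by case: ifPn => [/set_mem/H|_]; rewrite /= ?normr0 lee_fin.
Qed.

Lemma Linfty_norm_ge0 (I : set R) (f : R -> R) : (0 <= Linfty_norm I f)%E.
Proof. exact: Lnorm_ge0. Qed.

Lemma variation_on_bounded (D : set R) (g : R -> R) :
  (variation_on D g < +oo)%E -> exists2 M, 0 <= M & forall x, D x -> `|g x| <= M.
Proof.
move=> Voo; have [->|/set0P[y Dy]] := eqVneq D set0; first by exists 0.
have H x z : D x -> D z -> x < z -> (`|g z - g x|%:E <= variation_on D g)%E.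
  move=> Dx Dz xz; apply: ereal_sup_ubound; exists [:: x; z] => /=.
    split; first by rewrite /= xz.
    by move=> t; rewrite !inE => /orP[] /eqP ->.
  by rewrite big_nat1.
have Vfin : exists2 V, 0 <= V & forall x, D x -> `|g x - g y| <= V.
  have V0 : (0 <= variation_on D g)%E.
    apply: ereal_sup_ubound; exists [::]; last by rewrite big_geq.
    by split => // t; rewrite in_nil.
  have Vfin : variation_on D g \is a fin_num by rewrite ge0_fin_numE.
  exists (fine (variation_on D g)); first exact: fine_ge0.
  move=> x Dx; rewrite -lee_fin fineK//.
  have [xy|yx|->] := ltgtP x y; last by rewrite subrr normr0.
    by rewrite distrC; exact: H.
  exact: H.
have [V V0 HV] := Vfin.
exists (V + `|g y|) => [|x Dx]; first by rewrite addr_ge0.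
by have := HV x Dx; have := ler_normD (g x - g y) (g y); rewrite subrK; lra.
Qed.

Lemma interior_between (I : set R) y t z : is_interval I -> I y -> I z -> y < t < z -> I° t.
Proof.
move=> itvI Iy Iz ytz.
have : nbhs t `]y, z[%classic.
  by apply: open_nbhs_nbhs; split; [exact: interval_open|rewrite /= in_itv].
apply: filterS => w; rewrite /= in_itv/= => /andP[yw wz].
by apply: (itvI y z) => //; rewrite !ltW.
Qed.

Lemma interior_bracket (I : set R) t : I° t ->
  exists p q : rat, [/\ I (ratr p), I (ratr q) & ratr p < t < ratr q].
Proof.
move=> [d /= d0 dI].
have td : t - d < t by rewrite ltrBlDr ltrDl.
have dt : t < t + d by rewrite ltrDl.
have [p] := rat_in_itvoo td; rewrite in_itv/= => /andP[tp pt].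
have [q] := rat_in_itvoo dt; rewrite in_itv/= => /andP[tq qt].
exists p, q; split; last by rewrite pt tq.
  by apply: dI => /=; move: (ratr p : R) tp pt => y; rewrite ltr_norml; lra.
by apply: dI => /=; move: (ratr q : R) tq qt => y; rewrite ltr_norml; lra.
Qed.

(** On an unbounded side [inf I] or [sup I] is a default value, which is harmless in an inclusion:
    [I] differs from its interior by a null set in all cases. *)
Lemma interval_interior_ends (I : set R) : is_interval I ->
  I `<=` I° `|` [set inf I; sup I].
Proof.
move=> itvI t It; have [Iot|nIot] := pselect (I° t); [by left|right].
have [[y [Iy yt]]|nlo] := pselect (exists y, I y /\ y < t).
  right; apply/eqP; rewrite eq_le; apply/andP; split.
  - apply: ub_le_sup => //; exists t => z Iz; rewrite leNgt; apply/negP => tz.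
    by apply: nIot; apply: (interior_between itvI Iy Iz); rewrite yt.
  - apply: ge_sup; first by exists t.
    move=> z Iz; rewrite leNgt; apply/negP => tz.
    by apply: nIot; apply: (interior_between itvI Iy Iz); rewrite yt.
have lbt : lbound I t.
  by move=> y Iy; rewrite leNgt; apply/negP => yt; apply: nlo; exists y.
left; apply/eqP; rewrite eq_le; apply/andP; split.
  by apply: lb_le_inf => //; exists t.
by apply: ge_inf => //; exists t.
Qed.

Lemma ae_neq (a : R) : {ae mu, forall t, t <> a}.
Proof.
exists [set a]; split => //; first exact: lebesgue_measure_set1.
by move=> t /= /contrapT.
Qed.

Lemma ae_interior (I : set R) (P : R -> Prop) : is_interval I ->
  {ae mu, forall t, I° t -> P t} -> {ae mu, forall t, I t -> P t}.
Proof.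
move=> itvI aeP.
apply: (ae_mono (ae_and aeP (ae_and (ae_neq (inf I)) (ae_neq (sup I))))).
by move=> t [Pt [ti ts]] /(interval_interior_ends itvI)[/Pt//|[]].
Qed.

(** The interior is a countable union of open intervals with rational ends in [I], on each of which
    the fundamental theorem applies; at most two end points remain, negligible and measurable. *)
Lemma absolutely_continuous_on_derive1 (I : set R) (u : R -> R) : is_interval I ->
  absolutely_continuous_on I u ->
  [/\ {ae mu, forall t, I t -> derive1_dom I u t},
    measurable_fun I (derive1 u) &
    forall x y, I x -> I y -> x <= y ->
      u y - u x = (\int[mu]_(t in `]x, y[) derive1 u t)%R].
Proof.
move=> itvI acu.
pose F (n : nat) : set R := if unpickle n is Some (p, q) then
  [set t | [/\ I (ratr p), I (ratr q) & (ratr p : R) < t < ratr q]] else set0.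
have FE n : F n = set0 \/ exists p q : R, [/\ I p, I q, p < q & F n = `]p, q[%classic].
  rewrite /F; case: unpickle => [[p q]|]; last by left.
  have [[Ip Iq]|npq] := pselect (I (ratr p) /\ I (ratr q)); last first.
    by left; apply/seteqP; split => // t [Ip Iq _]; apply: npq.
  have [qp|pq] := leP (ratr q : R) (ratr p).
    left; apply/seteqP; split => // t [_ _ /andP[pt tq]].
    by move: (lt_trans pt tq); rewrite ltNge qp.
  right; exists (ratr p), (ratr q); split => //.
  by apply/seteqP; split => t /=; rewrite in_itv/=; [case|].
have FI : I° `<=` \bigcup_n F n.
  move=> t /interior_bracket[p [q [Ip Iq ptq]]].
  have [n nE] : exists n, unpickle n = Some (p, q).
    by exists (pickle (p, q)); exact: pickleK.
  by exists n => //; rewrite /F nE.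
have IF : \bigcup_n F n `<=` I°.
  move=> t [n _]; have [->//|[p [q [Ip Iq _ ->]]]] := FE n.
  by rewrite /= in_itv/=; exact: (interior_between itvI Ip Iq).
split.
- apply: ae_interior => //.
  have aeF : {ae mu, forall t, forall n, F n t -> derivable u t 1}.
    apply: ae_foralln => n; have [->|[p [q [Ip Iq pq ->]]]] := FE n.
      by apply: (ae_mono (ae_neq 0)).
    have [H _ _ _] := absolutely_continuous_on_FTC itvI acu Ip Iq pq.
    by apply: (ae_mono H) => t Ht; rewrite /= in_itv.
  by apply: (ae_mono aeF) => t Ht It; split => //; have [n _ /Ht] := FI t It.
- have mI : measurable (I : set (measurableTypeR R)) by exact: is_interval_measurable.
  have mIo : measurable (I° : set (measurableTypeR R)).
    by apply: open_measurable; exact: open_interior.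
  have -> : I = I° `|` (I `&` [set inf I; sup I]).
    apply/seteqP; split => [t It|t [/interior_subset//|[]]//].
    by have [|] := interval_interior_ends itvI It; [left|right].
  apply/measurable_funU => //.
    by apply: measurableI => //; apply: measurableU; exact: measurable_set1.
  split.
    have -> : I° = \bigcup_n F n by apply/seteqP.
    apply/measurable_fun_bigcup => n.
      have [->|[p [q [_ _ _ ->]]]] := FE n; first exact: measurable0.
      exact: measurable_itv.
    have [->|[p [q [Ip Iq pq ->]]]] := FE n; first exact: measurable_fun_set0.
    by have [_ H _ _] := absolutely_continuous_on_FTC itvI acu Ip Iq pq.
  apply: (@measurable_funS _ _ _ _ ([set inf I] `|` [set sup I])).
  - by apply: measurableU; exact: measurable_set1.
  - by move=> t [].
  - apply/measurable_funU; [exact: measurable_set1|exact: measurable_set1|].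
    by split; exact: measurable_fun_set1.
- move=> x y Ix Iy; rewrite le_eqVlt => /predU1P[<-|xy].
    by rewrite set_itvoo0 Rintegral_set0 subrr.
  have [_ _ _ H] := absolutely_continuous_on_FTC itvI acu Ix Iy xy.
  by apply: H => //; exact: ltW.
Qed.

End assembly.

(** * Windows and the final estimate *)

Section final.
Context {R : realType}.
Notation mu := (@lebesgue_measure R).

(* [w = 2] when the window may extend on both sides of a point of [I], [w = 1]
   when it may only extend on one side. *)
Definition has_windows (I : set R) (w : R) := forall s al be : R, 0 < s ->
  al <= be -> `[al, be] `<=` I° -> exists a' b',
    [/\ `[a', b'] `<=` I°, a' < al, be < b' & forall x, al <= x <= be ->
      exists a, [/\ a' < a, a + w * s < b', x - s <= a & a + w * s <= x + s]].

Lemma has_windows_setT : has_windows setT 2.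
Proof.
move=> s al be s0 albe _; exists (al - s - 1), (be + s + 1); rewrite interiorT.
split => //; [lra|lra|move=> x /andP[ax xb]].
by exists (x - s); split; lra.
Qed.

(** An interval of infinite measure is unbounded on some side, and all windows are turned to that
    side. *)
Lemma has_windows_infinite (I : set R) : is_interval I ->
  mu I = +oo%E -> has_windows I 1.
Proof.
move=> itvI Ioo s al be s0 albe abI.
have mem t : al <= t <= be -> I° t by move=> h; apply: abI; rewrite /= in_itv.
have Ioal : I° al by apply: mem; rewrite lexx.
have Iobe : I° be by apply: mem; rewrite lexx andbT.
have [d /= d0 dI] : nbhs al I by exact: Ioal.
have [d' /= d'0 d'I] : nbhs be I by exact: Iobe.
have Ial : I (al - d / 2).
  by apply: dI; rewrite /= opprB addrC subrK gtr0_norm; lra.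
have Ibe : I (be + d' / 2).
  by apply: d'I; rewrite /= opprD addrA subrr sub0r normrN gtr0_norm; lra.
have [hub|nub] := pselect (has_ubound I).
  have [hlb|nlb] := pselect (has_lbound I).
    have [B ubB] := hub; have [A lbA] := hlb.
    have : (mu I <= mu `[A, B]%classic)%E.
      apply: le_measure; rewrite ?inE//; first exact: is_interval_measurable.
      by move=> t It; rewrite /= in_itv/= lbA// ubB.
    rewrite Ioo leye_eq lebesgue_measure_itv/=; case: ifP => //.
  have [y [Iy yal]] : exists y, I y /\ y < al - s - 1.
    apply: contrapT => H; apply: nlb; exists (al - s - 1) => y Iy.
    by rewrite leNgt; apply/negP => h; apply: H; exists y.
  exists (al - s - 1), (be + d' / 4); split; [|lra|lra|].
    move=> t; rewrite /= in_itv/= => /andP[h1 h2].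
    by apply: (interior_between itvI Iy Ibe); apply/andP; split; lra.
  by move=> x /andP[ax xb]; exists (x - s); split; lra.
have [y [Iy yal]] : exists y, I y /\ be + s + 1 < y.
  apply: contrapT => H; apply: nub; exists (be + s + 1) => y Iy.
  by rewrite leNgt; apply/negP => h; apply: H; exists y.
exists (al - d / 4), (be + s + 1); split; [|lra|lra|].
  move=> t; rewrite /= in_itv/= => /andP[h1 h2].
  by apply: (interior_between itvI Ial Iy); apply/andP; split; lra.
by move=> x /andP[ax xb]; exists x; split; lra.
Qed.

Lemma Linfty_norm_distr_deriv_ge0 (I : set R) (f : R -> \bar R) :
  (0 <= Linfty_norm_distr_deriv I f)%E.
Proof. by apply: le_ereal_inf_tmp => _ [h _ <-]; exact: Linfty_norm_ge0. Qed.

Lemma landau_one_sign (I : set R) (u f : R -> R) (N U k w : R) :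
  is_interval I -> has_windows I w -> 0 <= w -> 0 < N -> 0 <= U -> measurable_fun I f ->
  {ae mu, forall t, I t -> `|f t| <= N} ->
  (forall x y, I x -> I y -> x <= y -> u y - u x = (\int[mu]_(t in `]x, y[) f t)%R) ->
  (forall x, I x -> `|u x| <= U) ->
  ~ mu.-negligible ([set t | N - N / 64 < f t] `&` I°) ->
  Linfty_norm_distr_deriv I (maximal_on I f^\+%R) = k%:E ->
  3 * w * N ^+ 2 <= 128 * U * k.
Proof.
move=> itvI win w0 N0 U0 mf fN uf uU nneg kE.
have k0 : 0 <= k by rewrite -lee_fin -kE Linfty_norm_distr_deriv_ge0.
apply/ler_addgt0Pr => e e0.
pose d := e / (128 * U + 1).
have U1 : 0 < 128 * U + 1 by rewrite ltr_wpDl// mulr_ge0.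
have d0 : 0 < d by rewrite divr_gt0.
(* The infimum [k] need not be known to be attained, and it may be 0; [K] is positive and bounds an
   actual derivative. *)
pose K := k + d.
have K0 : 0 < K by rewrite ltr_wpDl.
have /ereal_inf_lt[_ [h dh <-] hK] : (Linfty_norm_distr_deriv I (maximal_on I f^\+%R) < K%:E)%E.
  by rewrite kE lte_fin ltrDl.
have aeh : {ae mu, forall t, I° t -> `|h t| <= K}.
  apply: (ae_mono ((Linfty_norm_le I h (ltW K0)).1 (ltW hK))) => t H It.
  by apply: H; exact: interior_subset.
pose s := N / (8 * K).
have s0 : 0 < s by rewrite divr_gt0// mulr_gt0.
have Ks : K * s <= N / 8.
  by rewrite le_eqVlt; apply/orP; left; apply/eqP; rewrite /s; field; rewrite gt_eqF.
have := maximal_on_landau itvI N0 (ltW K0) Ks mf fN uf uU nneg dh aeh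
  (fun al be => win s al be s0) (mulr_ge0 w0 (ltW s0)).
(* Comparison with 2 U gives the factor 128 = 2 * 64. *)
have -> : 3 / 8 * N * (w * s) = 3 * w * N ^+ 2 / (64 * K).
  by rewrite /s; field; rewrite gt_eqF.
rewrite ler_pdivrMr ?mulr_gt0// => H; apply: le_trans H _.
have -> : 2 * U * (64 * K) = 128 * U * k + 128 * U * d by rewrite /K; ring.
by rewrite lerD2l /d mulrCA ger_pMr// ler_pdivrMr// mul1r lerDl.
Qed.

(** The end points of a chain cannot be chosen, so the bound on [u] is needed at every point;
    continuity carries it over from almost every point. Infinite measure ensures that [I] is more
    than a point. *)
Lemma lipschitz_ae_bound (I : set R) (u : R -> R) (N U : R) :
  is_interval I -> mu I = +oo%E -> 0 <= N ->
  (forall x y, I x -> I y -> x <= y -> `|u y - u x| <= N * (y - x)) ->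
  {ae mu, forall t, I t -> `|u t| <= U} -> forall x, I x -> `|u x| <= U.
Proof.
move=> itvI Ioo N0 lip aeU x Ix; apply/ler_addgt0Pr => e e0.
pose d := e / (N + 1).
have N1 : 0 < N + 1 by rewrite ltr_wpDl.
have d0 : 0 < d by rewrite divr_gt0.
have Nd : N * d <= e by rewrite /d mulrCA ger_pMr// ler_pdivrMr// mul1r lerDl.
have pick p q : p < q -> `]p, q[ `<=` I -> exists2 y, p < y < q & `|u y| <= U.
  move=> pq pqI.
  have nneg : ~ mu.-negligible `]p, q[%classic.
    have mpq : mu `]p, q[%classic = (q - p)%:E.
      by rewrite lebesgue_measure_itv/= lte_fin pq EFinB.
    move=> /negligibleP => /(_ (measurable_itv _)).
    rewrite [X in X = _]mpq => -[] /eqP; apply/negP.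
    by rewrite subr_eq0 gt_eqF.
  have [y [ypq Uy]] := nonnegligible_ae nneg aeU.
  exists y; last by apply/Uy/pqI.
  by move: ypq; rewrite /= in_itv.
have [z [Iz zx]] : exists z, I z /\ z <> x.
  apply: contrapT => H; have Ix1 : I `<=` [set x].
    by move=> z Iz; apply: contrapT => zx; apply: H; exists z.
  have : (mu I <= mu [set x])%E.
    by apply: le_measure; rewrite ?inE//; exact: is_interval_measurable.
  by rewrite Ioo leye_eq lebesgue_measure_set1.
have tri (v : R) : `|u x - v| <= e -> `|v| <= U -> `|u x| <= U + e.
  by rewrite !ler_norml; lra.
move: zx => /eqP; rewrite neq_lt => /orP[zx|xz].
  have [||y /andP[my yx] Uy] := pick (Num.max z (x - d)) x.
  - by rewrite gt_max zx ltrBlDr ltrDl.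
  - move=> t; rewrite /= in_itv/= gt_max => /andP[/andP[zt _] tx].
    by apply: (itvI z x) => //; rewrite !ltW.
  move: my; rewrite gt_max => /andP[zy xdy].
  have Iy : I y by apply: (itvI z x) => //; rewrite !ltW.
  apply: tri Uy; apply: le_trans (lip _ _ Iy Ix (ltW yx)) _.
  by apply: le_trans Nd; rewrite ler_wpM2l//; lra.
have [||y /andP[xy ym] Uy] := pick x (Num.min z (x + d)).
- by rewrite lt_min xz ltrDl.
- move=> t; rewrite /= in_itv/= lt_min => /andP[xt /andP[tz _]].
  by apply: (itvI x z) => //; rewrite !ltW.
move: ym; rewrite lt_min => /andP[yz yxd].
have Iy : I y by apply: (itvI x z) => //; rewrite !ltW.
apply: tri Uy; rewrite distrC; apply: le_trans (lip _ _ Ix Iy (ltW xy)) _.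
by apply: le_trans Nd; rewrite ler_wpM2l//; lra.
Qed.

Lemma landau_maximal (I : set R) (u : R -> R) (w C : R) (k1 k2 : \bar R) :
  is_interval I -> mu I = +oo%E -> absolutely_continuous_on I u ->
  (variation_on (derive1_dom I u) (derive1 u) < +oo)%E ->
  has_windows I w -> 0 < w -> 128 <= C * (3 * w) ->
  k1 = Linfty_norm_distr_deriv I (maximal_on I (derive1 u)^\+%R) ->
  k2 = Linfty_norm_distr_deriv I (maximal_on I (derive1 u)^\-%R) ->
  ((Linfty_norm I (derive1 u)) ^+ 2 <= C%:E * mule_oo (Linfty_norm I u) (k1 + k2))%E.
Proof.
move=> itvI Ioo acu bv win w0 C3w k1E k2E.
have C0 : 0 < C by rewrite -(pmulr_lgt0 _ (_ : 0 < 3 * w)); lra.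
have [aeD mf uf] := absolutely_continuous_on_derive1 itvI acu.
move: (derive1 u) k1E k2E aeD mf uf bv => f k1E k2E aeD mf uf bv.
have [M M0 HM] := variation_on_bounded bv.
have Nfin : Linfty_norm I f \is a fin_num.
  rewrite ge0_fin_numE ?Linfty_norm_ge0//; apply: (@le_lt_trans _ _ M%:E); last exact: ltry.
  by apply/Linfty_norm_le => //; apply: (ae_mono aeD) => t H /H /HM.
have k10 : (0 <= k1)%E by rewrite k1E; exact: Linfty_norm_distr_deriv_ge0.
have k20 : (0 <= k2)%E by rewrite k2E; exact: Linfty_norm_distr_deriv_ge0.
have U0 := Linfty_norm_ge0 I u.
rewrite /mule_oo; case: ifPn => [_|]; first by rewrite gt0_muley ?lte_fin// leey.
rewrite negb_or => /andP[Uoo koo].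
have Ufin : Linfty_norm I u \is a fin_num by rewrite ge0_fin_numE// lt_neqAle Uoo leey.
have : k1 + k2 \is a fin_num.
  by rewrite ge0_fin_numE ?adde_ge0// lt_neqAle koo leey.
rewrite fin_numD => /andP[k1fin k2fin].
set N := fine (Linfty_norm I f); set U := fine (Linfty_norm I u).
have NE : Linfty_norm I f = N%:E by rewrite fineK.
have UE : Linfty_norm I u = U%:E by rewrite fineK.
have N0 : 0 <= N by rewrite fine_ge0// Linfty_norm_ge0.
have {}U0 : 0 <= U by rewrite fine_ge0.
have fN : {ae mu, forall t, I t -> `|f t| <= N} by apply/Linfty_norm_le => //; rewrite NE.
have aeU : {ae mu, forall t, I t -> `|u t| <= U} by apply/Linfty_norm_le => //; rewrite UE.
have lip := bounded_derivative_lipschitz itvI N0 mf fN uf.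
have uU x : I x -> `|u x| <= U by exact: (lipschitz_ae_bound itvI Ioo N0 lip aeU).
have k1F : k1 = (fine k1)%:E by rewrite fineK.
have k2F : k2 = (fine k2)%:E by rewrite fineK.
have k1f0 : 0 <= fine k1 by rewrite fine_ge0.
have k2f0 : 0 <= fine k2 by rewrite fine_ge0.
rewrite NE UE k1F k2F -EFinD -!EFinM lee_fin -expr2.
have [N00|Nn0] := eqVneq N 0.
  by rewrite N00 expr0n/= !mulr_ge0 ?addr_ge0// ltW.
have N0' := N0.
have {}N0 : 0 < N by rewrite lt_neqAle eq_sym Nn0.
have concl k : 0 <= k -> k <= fine k1 + fine k2 ->
    3 * w * N ^+ 2 <= 128 * U * k -> N ^+ 2 <= C * (U * (fine k1 + fine k2)).
  move=> kk0 kle H; have w3 : 0 < 3 * w by lra.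
  rewrite -(ler_pM2l w3); apply: le_trans H _.
  have -> : 3 * w * (C * (U * (fine k1 + fine k2))) =
    C * (3 * w) * (U * (fine k1 + fine k2)) by ring.
  rewrite -mulrA; apply: ler_pM => //; first exact: mulr_ge0.
  exact: ler_wpM2l.
(* Otherwise N - N / 64 would be an essential bound smaller than the norm N. *)
have nneg : ~ mu.-negligible ([set t | N - N / 64 < `|f t|] `&` I°).
  move=> neg; have N64 : 0 <= N - N / 64 by lra.
  suff : N <= N - N / 64 by lra.
  rewrite -lee_fin -NE; apply/Linfty_norm_le => //; apply: ae_interior => //.
  apply: negligibleS neg => t /= H; split.
    by rewrite ltNge; apply/negP => h; apply: H.
  by apply: contrapT => nIt; apply: H.
have [pos|npos] := pselect (mu.-negligible ([set t | N - N / 64 < f t] `&` I°)); last first.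
  apply: (concl (fine k1)) => //; first by rewrite lerDl.
  apply: (landau_one_sign itvI win (ltW w0) N0 U0 mf fN uf uU npos).
  by rewrite -k1E -k1F.
apply: (concl (fine k2)) => //; first by rewrite lerDr.
have fneg : (\- f)^\+%R = f^\-%R by apply/funext => t.
(* Since [f] is rarely close to N, [- f] must be, and [- u] has the same bound [U]. *)
apply: (@landau_one_sign I (\- u) (\- f) N U (fine k2) w itvI win (ltW w0) N0 U0).
- exact: measurableT_comp.
- by apply: (ae_mono fN) => t H /H; rewrite normrN.
- move=> x y Ix Iy xy /=; rewrite -opprD uf//.
  have ixy : mu.-integrable `]x, y[ (EFin \o f).
    apply: (bounded_derivative_integrable itvI N0' mf fN); first exact: measurable_itv.
      move=> t; rewrite /= in_itv/= => /andP[xt ty].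
      by apply: (itvI x y) => //; rewrite !ltW.
    by rewrite /= lebesgue_measure_itv/=; case: ifP => // _; rewrite -EFinB ltry.
  rewrite -mulN1r -RintegralZl//; apply: eq_Rintegral => t _.
  by rewrite mulN1r.
- by move=> x Ix; rewrite /= normrN; exact: uU.
- move=> neg; apply: nneg; apply: negligibleS (negligibleU pos neg).
  move=> t [/= ft It]; have [f0|f0] := leP 0 (f t).
    by left; split => //=; move: ft; rewrite ger0_norm.
  by right; split => //=; move: ft; rewrite ltr0_norm.
- by rewrite fneg -k2E -k2F.
Qed.

End final.

Theorem theorem5p1 (R : realType) (I : set R) (u : R -> R)
    (itvI : is_interval I) (I_infinite : lebesgue_measure I = +oo%E)
    (ac_u : absolutely_continuous_on I u)
    (bv_u' : (variation_on (derive1_dom I u) (derive1 u) < +oo)%E) :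
  let norm_DM g := Linfty_norm_distr_deriv I (maximal_on I g) in
  ((Linfty_norm I (derive1 u)) ^+ 2 <=
     48%:E * mule_oo (Linfty_norm I u)
               (norm_DM (derive1 u)^\+%R + norm_DM (derive1 u)^\-%R))%E /\
  (I = setT ->
   ((Linfty_norm I (derive1 u)) ^+ 2 <=
     24%:E * mule_oo (Linfty_norm I u)
               (norm_DM (derive1 u)^\+%R + norm_DM (derive1 u)^\-%R))%E).
Proof.
move=> norm_DM; split=> [|IT].
  (* The requirement 128 <= C (3 w) holds with 144 on the right in both cases: 48 * 3 for w = 1 and
     24 * 6 for w = 2. *)
  apply: landau_maximal (has_windows_infinite itvI I_infinite) _ _ erefl erefl => //.
  lra.
have win : has_windows I 2 by rewrite IT; exact: has_windows_setT.
by apply: landau_maximal win _ _ erefl erefl => //; lra.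
Qed.
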